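(* There exists a uniformly continuous function $f:[0,1]\to\mathbb{R}$ that is computable with finitely many mind changes (and hence low and limit computable), but that is not computable relative to the halting problem.
   Context: $\mathbb{R}$ and $[0,1]$ are computable metric spaces with the Euclidean metric and a standard numbering $\alpha$ of the rational numbers (in $[0,1]$, respectively), represented by the Cauchy representation $\delta(p):=\lim_{n\to\infty}\alpha p(n)$ with $\mathrm{dom}(\delta)=\{p\in\mathbb{N}^{\mathbb{N}}:(\forall k)(\forall n\geq k)\;|\alpha p(n)-\alpha p(k)|<2^{-k}$ and $(\alpha p(n))_n$ converges in the space$\}$. A function $f:X\to Y$ between spaces with representations $\delta_X,\delta_Y$ has one of the computability properties below if it has a realizer with that property, i.e. such an $F:\subseteq\mathbb{N}^{\mathbb{N}}\to\mathbb{N}^{\mathbb{N}}$ with $\delta_YF(p)=f\delta_X(p)$ for all $p\in\mathrm{dom}(\delta_X)$. A partial function $F:\subseteq\mathbb{N}^{\mathbb{N}}\to\mathbb{N}^{\mathbb{N}}$ is computable if there is a Turing machine (infinite input tape, one-way output tape) that on each $p\in\mathrm{dom}(F)$ produces $F(p)$ in the long run; it is limit computable if there is a Turing machine with a two-way output tape (it may revise its output) that on each $p\in\mathrm{dom}(F)$ computes $F(p)$ such that each output position $n$ has, after finitely many steps, the content $F(p)(n)$ and is never changed again; it is computable with finitely many mind changes if moreover for each fixed input $p\in\mathrm{dom}(F)$ the machine revises its output only finitely many times in total (over all positions); it is computable relative to $q\in\mathbb{N}^{\mathbb{N}}$ if there is a computable $G$ with $F(p)=G\langle q,p\rangle$ for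 all $p\in\mathrm{dom}(F)$, where $\langle q,p\rangle(2n):=q(n)$, $\langle q,p\rangle(2n+1):=p(n)$. Nothing is required outside $\mathrm{dom}(F)$. The Turing jump $\mathsf{J}:\mathbb{N}^{\mathbb{N}}\to\mathbb{N}^{\mathbb{N}}$ is given by $\mathsf{J}(p)(i)=1$ if the $i$-th Turing machine halts upon input $p$, and $0$ otherwise; it is injective. The halting problem is $0':=\mathsf{J}(000\dots)$. With $\langle n,k\rangle:=\frac12(n+k)(n+k+1)+k$, $\langle p_0,p_1,\dots\rangle\langle n,k\rangle:=p_n(k)$ and $\lim:\langle p_0,p_1,\dots\rangle\mapsto\lim_{i\to\infty}p_i$, a partial function $F$ on $\mathbb{N}^{\mathbb{N}}$ is low if $F=\mathsf{J}^{-1}\circ\lim\circ\,G$ for some computable $G:\subseteq\mathbb{N}^{\mathbb{N}}\to\mathbb{N}^{\mathbb{N}}$. *)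

(* Defs.v *)
From Stdlib Require Cantor.
From HB Require Import structures.
From mathcomp Require Import all_boot all_order all_algebra.
From mathcomp Require Import all_classical all_reals all_analysis.
Set Implicit Arguments.
Unset Strict Implicit.
Unset Printing Implicit Defensive.

Import Order.TTheory GRing.Theory Num.Theory.
Import numFieldNormedType.Exports.
Local Open Scope classical_set_scope.

Definition baire := nat -> nat.

Definition cantor_pair (n k : nat) : nat := Cantor.to_nat (n, k).

Lemma cantor_pairE n k : cantor_pair n k = ((n + k) * (n + k).+1)./2 + k.
Proof.
have := Cantor.to_nat_spec n k; rewrite -/(cantor_pair n k) => e.
have {}e : (cantor_pair n k).*2 = k.*2 + (n + k) * (n + k).+1.
  by rewrite -!muln2 (addnC n k); exact: e.
by rewrite -[LHS]doubleK e halfD odd_double andFb add0n doubleK addnC.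
Qed.

Definition interleave (q p : baire) : baire :=
  fun m => if odd m then p m./2 else q m./2.

(** * Turing machines

Multitape machines with a read-only two-way input tape, finitely many two-way
infinite work tapes, and an output tape.  States and work symbols are natural
numbers (a machine has finitely many rules, so only finitely many of them
matter); the initial state is 0 and the blank work symbol is 0.  A machine
halts when no rule applies; if several apply, the first one is used. *)

Inductive dir := GoLeft | Stay | GoRight.

(** In [rule_work], the [i]-th triple [(a, b, d)] says: [a] is read on the
[i]-th work tape, [b] is written there, and the head is moved by [d].  In
[rule_out], [(o, d)] says: write the bit [b] if [o = Some b] and nothing if
[o = None], then move by [d]. *)
Record rule := Rule {
  rule_src : nat;
  rule_bit : bool;
  rule_work : seq (nat * nat * dir);
  rule_dst : nat;
  rule_in : dir;
  rule_out : option bool * dir }.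

Record machine := Machine { ntapes : nat; rules : seq rule }.

(** Countable structures, only used to number the machines. *)
Definition nat_of_dir (d : dir) : nat :=
  match d with GoLeft => 0 | Stay => 1 | GoRight => 2 end.
Definition dir_of_nat (n : nat) : dir :=
  match n with 0 => GoLeft | 1 => Stay | _ => GoRight end.
Lemma nat_of_dirK : cancel nat_of_dir dir_of_nat. Proof. by case. Qed.
HB.instance Definition _ := Countable.copy dir (can_type nat_of_dirK).

Definition tuple_of_rule (r : rule) :=
  (rule_src r, rule_bit r, rule_work r, rule_dst r, rule_in r, rule_out r).
Definition rule_of_tuple t : rule :=
  let: (q, b, w, q', d, o) := t in Rule q b w q' d o.
Lemma tuple_of_ruleK : cancel tuple_of_rule rule_of_tuple.
Proof. by case. Qed.
HB.instance Definition _ := Countable.copy rule (can_type tuple_of_ruleK).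

Definition pair_of_machine (M : machine) := (ntapes M, rules M).
Definition machine_of_pair t : machine := let: (k, s) := t in Machine k s.
Lemma pair_of_machineK : cancel pair_of_machine machine_of_pair.
Proof. by case. Qed.
HB.instance Definition _ := Countable.copy machine (can_type pair_of_machineK).

(** [pickle] and [unpickle] are here explicit primitive recursive codings, so
this is an effective numbering of all machines. *)
Definition nth_machine (i : nat) : machine :=
  odflt (Machine 0 [::]) (unpickle i).

(** Two half-tapes, nearest cell first, blank beyond their ends. *)
Record tape := Tape { tleft : seq nat; tsym : nat; tright : seq nat }.

Definition move_tape (d : dir) (t : tape) : tape :=
  let: Tape l a r := t in
  match d with
  | GoLeft => Tape (behead l) (head 0 l) (a :: r)
  | Stay => t
  | GoRight => Tape (a :: l) (head 0 r) (behead r)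
  end.

Definition write_tape (b : nat) (t : tape) : tape :=
  Tape (tleft t) b (tright t).

(** Heads on one-way infinite tapes; moving left from cell 0 has no effect. *)
Definition move_head (d : dir) (n : nat) : nat :=
  match d with GoLeft => n.-1 | Stay => n | GoRight => n.+1 end.

(** Output cells are blank ([None]) or contain a bit. *)
Record config := Config {
  cstate : nat;
  cin : nat;
  cwork : seq tape;
  cout : nat -> option bool;
  coutpos : nat }.

Definition init (M : machine) : config :=
  Config 0 0 (nseq (ntapes M) (Tape [::] 0 [::])) (fun=> None) 0.

Definition applicable (x : nat -> bool) (c : config) (r : rule) : bool :=
  [&& rule_src r == cstate c, rule_bit r == x (cin c)
    & [seq w.1.1 | w <- rule_work r] == [seq tsym t | t <- cwork c]].

Definition apply_rule (r : rule) (c : config) : config :=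
  Config (rule_dst r) (move_head (rule_in r) (cin c))
    [seq move_tape wt.1.2 (write_tape wt.1.1.2 wt.2)
       | wt <- zip (rule_work r) (cwork c)]
    (fun n => if (n == coutpos c) && (rule_out r).1
              then (rule_out r).1 else cout c n)
    (move_head (rule_out r).2 (coutpos c)).

Definition step (M : machine) (x : nat -> bool) (c : config) : config :=
  if [seq r <- rules M | applicable x c r] is r :: _
  then apply_rule r c else c.

(** The tape content [1^(p 0) 0 1^(p 1) 0 1^(p 2) 0 ...] representing [p]: the
[n]-th 0 is in cell [n + \sum_(i < n.+1) p i]. *)
Definition unary (p : baire) (j : nat) : bool :=
  [forall n : 'I_j.+1, j != n + \sum_(i < n.+1) p i].

Definition run (M : machine) (p : baire) (t : nat) : config :=
  iter t (step M (unary p)) (init M).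

Definition halts (M : machine) (p : baire) : Prop :=
  exists t, ~~ has (applicable (unary p) (run M p t)) (rules M).

(** One-way output: the output head moves exactly when a bit is written, and
then to the right. *)
Definition one_way (M : machine) : bool :=
  all (fun r => match rule_out r with
                | (None, Stay) | (Some _, GoRight) => true
                | _ => false
                end) (rules M).

(** Every output cell is eventually never changed again, with the right
content.  For a [one_way] machine this just says that [q] is written. *)
Definition produces (M : machine) (p q : baire) : Prop :=
  forall j, \forall t \near \oo, cout (run M p t) j = Some (unary q j).

Definition revises (M : machine) (p : baire) (t : nat) : Prop :=
  exists j, cout (run M p t) j <> None /\
            cout (run M p t.+1) j <> cout (run M p t) j.

(** * Partial functions on Baire space *)

Record pfunction := PFunction {
  graph :> baire -> baire -> Prop;
  graph_unique : forall p q q', graph p q -> graph p q' -> q = q' }.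

Definition computable (F : pfunction) : Prop :=
  exists2 M, one_way M & forall p q, F p q -> produces M p q.

Definition limit_computable (F : pfunction) : Prop :=
  exists M, forall p q, F p q -> produces M p q.

Definition computable_fin_mind_changes (F : pfunction) : Prop :=
  exists M, forall p q, F p q ->
    produces M p q /\ finite_set [set t | revises M p t].

Definition computable_relative_to (q : baire) (F : pfunction) : Prop :=
  exists2 G, computable G & forall p r, F p r -> G (interleave q p) r.

Definition jump (p : baire) : baire :=
  fun i => if `[< halts (nth_machine i) p >] then 1 else 0.

Definition halting_problem : baire := jump (fun=> 0).

(** [is_limit r s]: [s] is the limit in Baire space of the sequence coded by
[r]. *)
Definition is_limit (r s : baire) : Prop :=
  forall k, \forall i \near \oo, r (cantor_pair i k) = s k.

Definition low (F : pfunction) : Prop :=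
  exists2 G, computable G &
    forall p q, F p q <-> exists r s, [/\ G p r, is_limit r s & jump q = s].

(** * Represented spaces *)

Section Representations.
Variable R : realType.
Local Open Scope ring_scope.

(** The numbering maps <<a, b>, c> to (a - b) / (c + 1). *)
Definition rat_numbering (n : nat) : R :=
  let: (m, c) := Cantor.of_nat n in
  let: (a, b) := Cantor.of_nat m in (a%:R - b%:R) / c.+1%:R.

Definition unit_rat_numbering (n : nat) : R :=
  let: (a, c) := Cantor.of_nat n in (minn a c.+1)%:R / c.+1%:R.

(** [p] is a name of [x] in the subspace [X] of the real line with dense
sequence [alpha]. *)
Definition cauchy_rep (X : set R) (alpha : nat -> R) (p : baire) (x : R) :=
  [/\ X x,
      forall k n, (k <= n)%N -> `|alpha (p n) - alpha (p k)| < 2 ^- k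
    & alpha (p n) @[n --> \oo] --> x].

Definition unit_interval : set R := `[0, 1]%classic.

Definition delta_real := cauchy_rep setT rat_numbering.
Definition delta_unit := cauchy_rep unit_interval unit_rat_numbering.

(** Only the values of [f] on [0,1] matter. *)
Definition realizes (F : pfunction) (f : R -> R) : Prop :=
  forall p x, delta_unit p x -> exists2 q, F p q & delta_real q (f x).

Definition has_realizer (P : pfunction -> Prop) (f : R -> R) : Prop :=
  exists2 F, realizes F f & P F.

End Representations.

(* Main.v *)
(** The function is a series of disjoint bumps accumulating at 0.  The bump
indexed by [n = <i, t>] sits at [2 ^- n], has height [2 ^- i], and is switched on
iff machine [i], run with oracle [0'] on the zero name of [0], needs exactly [t]
steps to produce the first [i + 3] values of its output.  For every [i] at most
one bump is on, so the function is uniformly continuous.  If machine [i] computed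
it relative to [0'], those [i + 3] values would force [|f y| < 2 ^- i] for every
[y] whose name agrees with the zero name for [t] symbols, but the top of the bump
[<i, t>] is such a [y].

A name of [x] eventually singles out the only bump that can matter at [x], or
none does; whether this bump is on depends on finitely many values of [0'], which
are limits of computable approximations, so finitely many guesses suffice.  For
lowness one approximates at stage [s] the jump of the output belonging to the
[s]-th guess by simulating all machines for [s] steps.

All this runs on the given machine model: primitive recursive functionals are
compiled to register programs and these to multitape machines, and the machines
themselves are simulated by a primitive recursive functional. *)

From Stdlib Require Cantor.
Require Import Defs.
From mathcomp Require Import all_boot all_order all_algebra.
From mathcomp Require Import all_classical all_reals all_analysis.
From mathcomp Require Import zify ring lra.
Import numFieldNormedType.Exports.

Set Implicit Arguments.
Unset Strict Implicit.
Unset Printing Implicit Defensive.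

(** * The unary input encoding *)

(** Away from 0 the function is computable relative to [0']. The obstacle sits at 0: there a machine
    must commit itself to a value up to 2 ^- i after finitely many steps, while the place of the
    bump of height 2 ^- i depends on how long that very machine runs. Having [i + 3] values means
    having entry [i + 2], which is exact up to 2 ^- (i + 2); the same rational would have to be that
    close both to 0 and to 2 ^- i. Since [t <= <i, t>], the peak of the bump has a name that starts
    with at least [t] entries of the zero name, and [t] steps cannot read further. Asking for
    exactly [t] steps rather than at most [t] leaves one bump of each height; otherwise bumps of
    height 2 ^- i would accumulate at 0 and destroy continuity. Lowness rests on more than limit
    computability: once the guess is stable, the output is computable from the input and one number,
    so halting on this output is semidecidable and its approximations converge. *)

Definition block_start (p : baire) (n : nat) := n + \sum_(i < n) p i.
Definition zero_pos (p : baire) (n : nat) := n + \sum_(i < n.+1) p i.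

Lemma zero_posE p n : zero_pos p n = block_start p n + p n.
Proof. by rewrite /zero_pos /block_start big_ord_recr addnA. Qed.

Lemma block_startS p n : block_start p n.+1 = (zero_pos p n).+1.
Proof. by []. Qed.

Lemma leq_block_start p m n : m <= n -> block_start p m <= block_start p n.
Proof.
elim: n => [|n IH]; first by rewrite leqn0 => /eqP ->.
rewrite leq_eqVlt => /predU1P[-> //|]; rewrite ltnS => /IH /leq_trans; apply.
by rewrite block_startS zero_posE -addnS leq_addr.
Qed.

Lemma leq_zero_pos p m n : m <= n -> zero_pos p m <= zero_pos p n.
Proof. by move=> mn; rewrite -ltnS -!block_startS leq_block_start. Qed.

Lemma zero_pos_ge p n : n <= zero_pos p n.
Proof. exact: leq_addr. Qed.

Lemma unaryP p j : reflect (exists n, j = zero_pos p n) (~~ unary p j).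
Proof.
apply: (iffP forallPn) => [[n /negPn/eqP ->]|[n ->]]; first by exists n.
have h : n < (zero_pos p n).+1 by rewrite ltnS zero_pos_ge.
by exists (Ordinal h); apply/negPn/eqP.
Qed.

Lemma unary_zero p n : unary p (zero_pos p n) = false.
Proof. by apply/negbTE/unaryP; exists n. Qed.

Lemma unary_one p n j : j < p n -> unary p (block_start p n + j).
Proof.
move=> jn; apply: contraT => /unaryP[m e].
have [lt_mn|le_nm] := ltnP m n.
  have := leq_block_start p lt_mn; rewrite block_startS -e.
  by rewrite -addnS -{2}(addn0 (block_start p n)) leq_add2l.
by have := leq_zero_pos p le_nm; rewrite -e zero_posE leq_add2l leqNgt jn.
Qed.

(** The [n]-th 0 lies in cell [n] or beyond, so only the entries up to index [j] can decide cell
    [j]. This turns agreement of names into agreement of tapes. *)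
Lemma unary_local p p' j :
  (forall i, i <= j -> p i = p' i) -> unary p j = unary p' j.
Proof.
move=> h; apply: eq_forallb => n; congr (_ != _ + _).
by apply: eq_bigr => i _; apply: h; rewrite -ltnS (leq_trans (ltn_ord i)).
Qed.

(** By strong induction the blocks before [k] coincide, so both [k]-th blocks begin in the same
    cell; if their lengths differed, the 0 ending the shorter one would face a 1. *)
Lemma unary_prefix p q k l : zero_pos p k < l ->
  (forall j, j < l -> unary p j = unary q j) -> p k = q k.
Proof.
move=> kl h; have [m] := ubnP k; elim: m => // m IH in k kl *; rewrite ltnS => km.
have e : block_start p k = block_start q k.
  congr (_ + _); apply: eq_bigr => i _; apply: IH; last exact: leq_trans km.
  by apply: leq_ltn_trans kl; apply/leq_zero_pos/ltnW.
case: (ltngtP (p k) (q k)) => // lt.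
  by have := unary_zero p k; rewrite h // zero_posE e unary_one.
have := unary_zero q k.
rewrite -h; first by rewrite zero_posE -e unary_one.
by apply: ltn_trans kl; rewrite !zero_posE e ltn_add2l.
Qed.

Lemma unary_inj p q : unary p =1 unary q -> p = q.
Proof.
by move=> h; apply: funext => k; apply: (@unary_prefix _ _ _ (zero_pos p k).+1).
Qed.

(** * Register programs *)

Inductive cmd :=
  | Skip
  | Inc of nat
  | Dec of nat
  | Fwd
  | Bwd
  | Cat of cmd & cmd
  | While of nat & cmd
  | WhileBit of cmd.

Definition upd (rho : nat -> nat) r v := fun i => if i == r then v else rho i.

Inductive exec (x : nat -> bool) : cmd -> (nat -> nat) -> nat ->
    (nat -> nat) -> nat -> Prop :=
  | ExSkip rho i : exec x Skip rho i rho i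
  | ExInc r rho i : exec x (Inc r) rho i (upd rho r (rho r).+1) i
  | ExDec r rho i : exec x (Dec r) rho i (upd rho r (rho r).-1) i
  | ExFwd rho i : exec x Fwd rho i rho i.+1
  | ExBwd rho i : exec x Bwd rho i rho i.-1
  | ExCat c1 c2 rho1 i1 rho2 i2 rho3 i3 :
      exec x c1 rho1 i1 rho2 i2 -> exec x c2 rho2 i2 rho3 i3 ->
      exec x (Cat c1 c2) rho1 i1 rho3 i3
  | ExWhile0 r c rho i : rho r = 0 -> exec x (While r c) rho i rho i
  | ExWhile r c rho1 i1 rho2 i2 rho3 i3 : 0 < rho1 r ->
      exec x c rho1 i1 rho2 i2 -> exec x (While r c) rho2 i2 rho3 i3 ->
      exec x (While r c) rho1 i1 rho3 i3
  | ExWhileBit0 c rho i : x i = false -> exec x (WhileBit c) rho i rho i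
  | ExWhileBit c rho1 i1 rho2 i2 rho3 i3 : x i1 ->
      exec x c rho1 i1 rho2 i2 -> exec x (WhileBit c) rho2 i2 rho3 i3 ->
      exec x (WhileBit c) rho1 i1 rho3 i3.

Fixpoint reg_bound c :=
  match c with
  | Skip | Fwd | Bwd => 0
  | Inc r | Dec r => r.+1
  | Cat c1 c2 => maxn (reg_bound c1) (reg_bound c2)
  | While r c => maxn r.+1 (reg_bound c)
  | WhileBit c => reg_bound c
  end.

(** * Flat programs and their Turing machines

Program counter [n] is state [n.+1]; state 0 puts the mark 1 on the leftmost
cell of every work tape.  Register [j] is the distance of the head of the
[j]-th work tape from that mark, and nothing is written afterwards. *)

Inductive instr :=
  | IInc of nat
  | IDec of nat
  | IMove of dir
  | IJz of nat & nat
  | IJb of nat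
  | IJmp of nat
  | IOut of option bool & dir.

Definition ireg i := match i with IInc r | IDec r | IJz r _ => r.+1 | _ => 0 end.

(** Reading 1 means that the head is on the mark, hence that the register is 0; [IDec] moves only
    off the mark, which gives the truncated predecessor. *)
Definition idirs i (w : seq nat) j :=
  match i with
  | IInc r => if j == r then GoRight else Stay
  | IDec r => if (j == r) && (nth 0 w r == 0) then GoLeft else Stay
  | _ => Stay
  end.

Definition idst i pc (b : bool) (w : seq nat) :=
  match i with
  | IJz r l => if nth 0 w r == 1 then l else pc.+1
  | IJb l => if b then pc.+1 else l
  | IJmp l => l
  | _ => pc.+1
  end.

Definition iin i := if i is IMove d then d else Stay.
Definition iout i := if i is IOut o d then (o, d) else (None, Stay).

Definition ireg_upd i (rho : nat -> nat) :=
  match i with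
  | IInc r => upd rho r (rho r).+1
  | IDec r => upd rho r (rho r).-1
  | _ => rho
  end.

(** Once the marks are placed, only 0 and 1 occur on the work tapes, so one rule for each of these
    words covers every reading. *)
Definition words k : seq (seq nat) :=
  [seq [seq nat_of_bool b | b <- val t] | t <- enum {: k.-tuple bool}].

Definition irule k pc i (b : bool) (w : seq nat) :=
  Rule pc.+1 b [seq (nth 0 w j, nth 0 w j, idirs i w j) | j <- iota 0 k]
    (idst i pc b w).+1 (iin i) (iout i).

Definition init_rule k b := Rule 0 b (nseq k (0, 1, Stay)) 1 Stay (None, Stay).

Definition prog_rules k (P : seq instr) :=
  flatten [seq [seq irule k pc (nth (IJmp 0) P pc) b w
                | b <- [:: true; false], w <- words k] | pc <- iota 0 (size P)].

Definition prog_machine k (P : seq instr) : machine :=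
  Machine k ([:: init_rule k true; init_rule k false] ++ prog_rules k P).

Lemma mem_irule k P pc b (v : nat -> bool) : pc < size P ->
  irule k pc (nth (IJmp 0) P pc) b [seq nat_of_bool (v j) | j <- iota 0 k]
    \in rules (prog_machine k P).
Proof.
move=> h; rewrite mem_cat; apply/orP; right.
apply/flattenP; exists [seq irule k pc (nth (IJmp 0) P pc) b w
                | b <- [:: true; false], w <- words k].
  by apply/mapP; exists pc; rewrite // mem_iota.
apply/allpairsP; exists (b, [seq nat_of_bool (v j) | j <- iota 0 k]) => /=.
split=> //; first by case: b.
apply/mapP; exists [tuple of [seq v j | j <- [tuple of iota 0 k]]].
  by rewrite mem_enum.
by rewrite /= -map_comp.
Qed.

Lemma step_unique M x c r : r \in rules M -> applicable x c r ->
  (forall r', r' \in rules M -> applicable x c r' -> r' = r) ->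
  step M x c = apply_rule r c.
Proof.
move=> rM ar uni; rewrite /step.
case e : [seq r <- rules M | applicable x c r] => [|r' s].
  have : r \in [seq r <- rules M | applicable x c r] by rewrite mem_filter ar.
  by rewrite e.
have : r' \in [seq r <- rules M | applicable x c r] by rewrite e mem_head.
by rewrite mem_filter => /andP[ar' r'M]; rewrite (uni r').
Qed.

(** The [m] blanks on the right are cells left behind by earlier, larger values of the register. *)
Definition counter n t : Prop := exists m,
  t = if n is n'.+1 then Tape (nseq n' 0 ++ [:: 1]) 0 (nseq m 0)
      else Tape [::] 1 (nseq m 0).

Lemma counter_sym n t : counter n t -> tsym t = (n == 0).
Proof. by case: n => [|n] [m ->]. Qed.

Lemma counter_right n t : counter n t -> counter n.+1 (move_tape GoRight t).
Proof.
by case: n => [|n] [m ->]; exists m.-1 => /=; congr Tape; case: m.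
Qed.

Lemma counter_left n t : counter n.+1 t -> counter n (move_tape GoLeft t).
Proof. by case: n => [|n] [m ->]; exists m.+1. Qed.

Definition blank := Tape [::] 0 [::].

Record rep k (cf : config) pc rho ip out op : Prop := Rep {
  rep_pc : cstate cf = pc.+1;
  rep_in : cin cf = ip;
  rep_size : size (cwork cf) = k;
  rep_work : forall j, j < k -> counter (rho j) (nth blank (cwork cf) j);
  rep_out : cout cf = out;
  rep_outpos : coutpos cf = op }.

Lemma rep_syms k cf pc rho ip out op : rep k cf pc rho ip out op ->
  [seq tsym t | t <- cwork cf] = [seq nat_of_bool (rho j == 0) | j <- iota 0 k].
Proof.
move=> [_ _ sz wk _ _]; apply: (@eq_from_nth _ 0).
  by rewrite !size_map size_iota.
move=> j; rewrite size_map sz => jk.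
rewrite (nth_map blank) ?sz // (nth_map 0) ?size_iota // nth_iota // add0n.
exact/counter_sym/wk.
Qed.

Lemma words_size k w : w \in words k -> size w = k.
Proof. by case/mapP=> t _ ->; rewrite size_map size_tuple. Qed.

Lemma irule_reads k pc i b w : size w = k ->
  [seq w.1.1 | w <- rule_work (irule k pc i b w)] = w.
Proof.
move=> <-; rewrite /= -map_comp; apply: (@eq_from_nth _ 0).
  by rewrite size_map size_iota.
by move=> j; rewrite size_map size_iota => jk;
  rewrite (nth_map 0) ?size_iota // nth_iota.
Qed.

Definition out_upd (o : option bool) op (out : nat -> option bool) :=
  fun n => if (n == op) && o then o else out n.

Lemma step_rep k P x cf pc rho ip out op i :
  rep k cf pc rho ip out op -> onth P pc = Some i -> ireg i <= k ->
  rep k (step (prog_machine k P) x cf)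
    (idst i pc (x ip) [seq nat_of_bool (rho j == 0) | j <- iota 0 k])
    (ireg_upd i rho) (move_head (iin i) ip)
    (out_upd (iout i).1 op out) (move_head (iout i).2 op).
Proof.
move=> rp fe ik; have sy := rep_syms rp; case: rp => epc eip sz wk eo eop.
set w := [seq nat_of_bool (rho j == 0) | j <- iota 0 k] in sy *.
have pcP : pc < size P.
  by rewrite ltnNge; apply/negP => h; rewrite onth_default in fe.
have nP : nth (IJmp 0) P pc = i.
  exact: onth_nth fe.
have sw : size w = k by rewrite /w size_map size_iota.
rewrite (@step_unique _ _ _ (irule k pc i (x ip) w)).
- split=> //=.
  + by rewrite eip.
  + by rewrite size_map size_zip size_map size_iota sz minnn.
  + move=> j jk; have szz : size (zip [seq (nth 0 w j, nth 0 w j, idirs i w j)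
        | j <- iota 0 k] (cwork cf)) = k.
      by rewrite size_zip size_map size_iota sz minnn.
    rewrite (nth_map ((0, 0, Stay), blank)) ?szz //.
    rewrite nth_zip ?size_map ?size_iota ?sz //=.
    rewrite (nth_map 0) ?size_iota // nth_iota // add0n /=.
    have nw l : l < k -> nth 0 w l = (rho l == 0).
      by move=> lk; rewrite (nth_map 0) ?size_iota // nth_iota.
    have := wk j jk; set t := nth _ _ _ => ct.
    rewrite nw // -(counter_sym ct).
    have -> : write_tape (tsym t) t = t by case: t {ct}.
    case: i ik fe nP {szz} => //= r rk _ _; rewrite /upd; case: eqP => [ejr|_] //=.
      by rewrite -ejr; case: (t) ct => l a b ct; apply: (counter_right ct).
    rewrite nw // -ejr; case er : (rho j) ct => [|n] ct //=.
    by case: (t) ct => l a b ct; apply: (counter_left ct).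
  + by rewrite eo eop.
  + by rewrite eop.
- by rewrite -{1}nP; apply: mem_irule.
- by rewrite /applicable irule_reads // sy epc eip; apply/and3P; split=> /=.
move=> r; rewrite mem_cat => /orP[|].
  by rewrite !inE => /orP[]/eqP->; rewrite /applicable /= epc.
case/flattenP=> _ /mapP[pc' pc'P ->] /allpairsP[[b w'] /= [_ w'k ->]].
have sw' := words_size w'k.
rewrite /applicable sy irule_reads // => /and3P[/eqP]; rewrite /= epc => -[->].
by rewrite eip => /eqP -> /eqP ->; rewrite nP.
Qed.

Lemma init_rep k P x :
  rep k (step (prog_machine k P) x (init (prog_machine k P))) 0
    (fun=> 0) 0 (fun=> None) 0.
Proof.
rewrite (@step_unique _ _ _ (init_rule k (x 0))).
- split=> //; first by rewrite /= size_map size_zip !size_nseq minnn.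
  move=> j jk; rewrite /counter; exists 0 => /=.
  rewrite (nth_map ((0, 0, Stay), blank)) ?size_zip ?size_nseq ?minnn //.
  by rewrite nth_zip ?size_nseq //= !nth_nseq jk.
- by apply: funext => n /=; rewrite andbF.
- by case: (x 0); rewrite ?inE ?eqxx ?orbT.
- by rewrite /applicable /= eqxx /= !map_nseq eqxx.
move=> r; rewrite mem_cat => /orP[|].
  by rewrite !inE => /orP[]/eqP-> /and3P[_ /eqP /= <-].
by case/flattenP=> _ /mapP[pc' _ ->] /allpairsP[[b w'] /= [_ _ ->]].
Qed.

(** * Compilation *)

Fixpoint code_size c :=
  match c with
  | Skip => 0
  | Inc _ | Dec _ | Fwd | Bwd => 1
  | Cat c1 c2 => code_size c1 + code_size c2
  | While _ c | WhileBit c => (code_size c).+2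
  end.

(** Jumps are absolute, hence the parameter [o], the address of the first instruction. A loop is a
    test, its body and a jump back; leaving it leads just behind that jump. *)
Fixpoint code o c :=
  match c with
  | Skip => [::]
  | Inc r => [:: IInc r]
  | Dec r => [:: IDec r]
  | Fwd => [:: IMove GoRight]
  | Bwd => [:: IMove GoLeft]
  | Cat c1 c2 => code o c1 ++ code (o + code_size c1) c2
  | While r c => IJz r (o + (code_size c).+2) :: rcons (code o.+1 c) (IJmp o)
  | WhileBit c => IJb (o + (code_size c).+2) :: rcons (code o.+1 c) (IJmp o)
  end.

Lemma size_code o c : size (code o c) = code_size c.
Proof.
elim: c o => //= [c1 IH1 c2 IH2|r c IH|c IH] o; rewrite ?size_cat ?size_rcons.
- by rewrite IH1 IH2.
- by rewrite IH.
- by rewrite IH.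
Qed.

Lemma ireg_code k o c : reg_bound c <= k -> all (fun i => ireg i <= k) (code o c).
Proof.
elim: c o => //= [r|r|c1 IH1 c2 IH2|r c IH|c IH] o; rewrite ?andbT //.
- by rewrite geq_max all_cat => /andP[h1 h2]; rewrite IH1 ?IH2.
- by rewrite geq_max all_rcons /= => /andP[-> h]; rewrite IH.
- by rewrite all_rcons /= => h; rewrite IH.
Qed.

Definition at_pc (P : seq instr) o s := forall i, i < size s -> onth P (o + i) = onth s i.

Lemma at_pc_cat P o s1 s2 : at_pc P o (s1 ++ s2) ->
  at_pc P o s1 /\ at_pc P (o + size s1) s2.
Proof.
move=> h; split=> i ih.
  by rewrite h ?size_cat ?ltn_addr // onth_cat ih.
rewrite -addnA h ?size_cat ?ltn_add2l // onth_cat ltnNge leq_addr /=.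
by rewrite addKn.
Qed.

Lemma at_pc_cons P o i s : at_pc P o (i :: s) ->
  onth P o = Some i /\ at_pc P o.+1 s.
Proof.
move=> h; split; first by have := h 0 isT; rewrite addn0.
by move=> j js; have := h j.+1 js; rewrite addnS addSn.
Qed.

Lemma at_pc_rcons P o s i : at_pc P o (rcons s i) ->
  at_pc P o s /\ onth P (o + size s) = Some i.
Proof. by rewrite -cats1 => /at_pc_cat[? /at_pc_cons[]]. Qed.

Section Simulation.
Variables (k : nat) (P : seq instr) (x : nat -> bool).
Hypothesis Pk : all (fun i => ireg i <= k) P.

Let M := prog_machine k P.

Lemma onth_ireg pc i : onth P pc = Some i -> ireg i <= k.
Proof.
move=> e; have /(all_nthP (IJmp 0)) h := Pk.
have <- : nth (IJmp 0) P pc = i by exact: onth_nth e.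
apply: h.
by rewrite ltnNge; apply/negP => h; rewrite onth_default in e.
Qed.

(** The output is controlled at all intermediate steps too, because [produces] and [revises] speak
    about every moment of a run. *)
Definition silent cf cf' := exists t, iter t (step M x) cf = cf' /\
  forall t', t' <= t -> cout (iter t' (step M x) cf) = cout cf.

Lemma silent0 cf : silent cf cf.
Proof. by exists 0; split=> // t'; rewrite leqn0 => /eqP ->. Qed.

Lemma silent_trans cf1 cf2 cf3 : silent cf1 cf2 -> silent cf2 cf3 -> silent cf1 cf3.
Proof.
move=> [t1 [e1 h1]] [t2 [e2 h2]]; exists (t2 + t1); split.
  by rewrite iterD e1.
move=> t'; have [le _|lt] := leqP t' t1; first exact: h1.
rewrite addnC -leq_subLR => le.
by rewrite -(subnK (ltnW lt)) iterD e1 h2 // -e1 h1.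
Qed.

Lemma silent_step cf pc rho ip out op i pc' rho' ip' :
  rep k cf pc rho ip out op -> onth P pc = Some i ->
  idst i pc (x ip) [seq nat_of_bool (rho j == 0) | j <- iota 0 k] = pc' ->
  ireg_upd i rho = rho' -> move_head (iin i) ip = ip' ->
  iout i = (None, Stay) ->
  exists2 cf', silent cf cf' & rep k cf' pc' rho' ip' out op.
Proof.
move=> rp fe <- <- <- eo; exists (step M x cf).
  exists 1; split=> // -[|[|//]] // _.
  have := step_rep x rp fe (onth_ireg fe); rewrite -/M eo => -[_ _ _ _ /= -> _].
  by rewrite (rep_out rp); apply: funext => n; rewrite /out_upd andbF.
have := step_rep x rp fe (onth_ireg fe); rewrite eo /=.
by congr rep; apply: funext => n; rewrite /out_upd andbF.
Qed.

Lemma silent_code c rho ip rho' ip' o cf out op :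
  exec x c rho ip rho' ip' -> at_pc P o (code o c) ->
  rep k cf o rho ip out op ->
  exists2 cf', silent cf cf' & rep k cf' (o + code_size c) rho' ip' out op.
Proof.
move=> ex; elim: ex o cf => {c rho ip rho' ip'} /=.
- by move=> rho ip o cf _ rp; exists cf; [exact: silent0|rewrite addn0].
- move=> r rho ip o cf /at_pc_cons[fe _] rp.
  by rewrite addn1; apply: (silent_step rp fe).
- move=> r rho ip o cf /at_pc_cons[fe _] rp.
  by rewrite addn1; apply: (silent_step rp fe).
- move=> rho ip o cf /at_pc_cons[fe _] rp.
  by rewrite addn1; apply: (silent_step rp fe).
- move=> rho ip o cf /at_pc_cons[fe _] rp.
  by rewrite addn1; apply: (silent_step rp fe).
- move=> c1 c2 rho1 i1 rho2 i2 rho3 i3 _ IH1 _ IH2 o cf /at_pc_cat[a1 a2] rp.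
  rewrite size_code in a2.
  have [cf' s1 rp1] := IH1 _ _ a1 rp; have [cf'' s2 rp2] := IH2 _ _ a2 rp1.
  by exists cf''; [exact: silent_trans s1 s2|rewrite addnA].
- move=> r c rho ip r0 o cf /at_pc_cons[fe _] rp.
  apply: (silent_step rp fe) => //=.
  have rk := onth_ireg fe.
  by rewrite (nth_map 0) ?size_iota // nth_iota // add0n r0.
- move=> r c rho1 i1 rho2 i2 rho3 i3 r0 _ IH1 _ IH2 o cf ao rp.
  have [fe /at_pc_rcons[a1 fe2]] := at_pc_cons ao; rewrite size_code in fe2.
  have [|||//|cf1 s1 rp1] := silent_step rp fe (pc' := o.+1) (rho' := rho1) (ip' := i1).
  + have rk := onth_ireg fe.
    by rewrite /= (nth_map 0) ?size_iota // nth_iota // add0n -leqn0 leqNgt r0.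
  + by [].
  + by [].
  have [cf2 s2 rp2] := IH1 _ _ a1 rp1.
  have [|||//|cf3 s3 rp3] := silent_step rp2 fe2 (pc' := o) (rho' := rho2) (ip' := i2) => //.
  (* The remaining rounds start at the same address, so the induction hypothesis applies to the
     whole loop again. *)
  have [cf4 s4 rp4] := IH2 _ _ ao rp3.
  exists cf4 => //; apply: silent_trans s4; apply: silent_trans s3.
  exact: silent_trans s2.
- move=> c rho ip x0 o cf /at_pc_cons[fe _] rp.
  by apply: (silent_step rp fe) => //=; rewrite x0.
- move=> c rho1 i1 rho2 i2 rho3 i3 x1 _ IH1 _ IH2 o cf ao rp.
  have [fe /at_pc_rcons[a1 fe2]] := at_pc_cons ao; rewrite size_code in fe2.
  have [|||//|cf1 s1 rp1] := silent_step rp fe (pc' := o.+1) (rho' := rho1) (ip' := i1).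
  + by rewrite /= x1.
  + by [].
  + by [].
  have [cf2 s2 rp2] := IH1 _ _ a1 rp1.
  have [|||//|cf3 s3 rp3] := silent_step rp2 fe2 (pc' := o) (rho' := rho2) (ip' := i2) => //.
  have [cf4 s4 rp4] := IH2 _ _ ao rp3.
  exists cf4 => //; apply: silent_trans s4; apply: silent_trans s3.
  exact: silent_trans s2.
Qed.

End Simulation.

(** * Driving the output head by a program *)

Section Driver.
Variables (two_way : bool) (c : cmd) (A : baire -> nat -> nat).

Definition counter_state n : nat -> nat := upd (fun=> 0) 0 n.

Hypothesis cA : forall p n,
  exec (unary p) c (counter_state n) 0 (upd (counter_state n) 2 (A p n)) 0.
Hypothesis A2 : forall p n, A p n <= 2.

Definition back := if two_way then GoLeft else Stay.

(* Register 0 counts the rounds, register 2 receives the action of the round: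
   write 0 or 1 and move right, or (action 2) move back. *)
Definition driver := let l := code_size c in
  code 0 c ++ [:: IInc 0; IJz 2 (l + 7); IDec 2; IJz 2 (l + 9); IDec 2;
    IOut None back; IJmp 0; IOut (Some false) GoRight; IJmp 0;
    IOut (Some true) GoRight; IJmp 0].

Definition driver_machine := prog_machine (maxn 3 (reg_bound c)) driver.

Definition action a (s : (nat -> option bool) * nat) :=
  match a with
  | 0 => (out_upd (Some false) s.2 s.1, s.2.+1)
  | 1 => (out_upd (Some true) s.2 s.1, s.2.+1)
  | _ => (s.1, move_head back s.2)
  end.

Fixpoint actions p n :=
  if n is n'.+1 then action (A p n') (actions p n') else (fun=> None, 0).

Let k := maxn 3 (reg_bound c).
Let M := driver_machine.

Let driver_regs : all (fun i => ireg i <= k) driver.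
Proof.
have k3 : 2 < k by exact: leq_maxl.
by rewrite all_cat ireg_code ?leq_maxr //= k3 (ltnW (ltnW k3)).
Qed.

Lemma driver_one_way : ~~ two_way -> one_way M.
Proof.
move=> tw; pose ok i := match iout i with
  | (None, Stay) | (Some _, GoRight) => true | _ => false end.
have okc o d : all ok (code o d).
  elim: d o => //= [c1 IH1 c2 IH2|r d IH|d IH] o.
  - by rewrite all_cat IH1 IH2.
  - by rewrite all_rcons IH.
  - by rewrite all_rcons IH.
have okd : all ok driver by rewrite all_cat okc /= /ok /= /back (negbTE tw).
rewrite /one_way /=; apply/allP => r /flattenP[s /mapP[pc + ->]].
rewrite mem_iota => pcs /allpairsP[[b w] /= [_ _ ->]].
by have /(all_nthP (IJmp 0)) := okd; apply.
Qed.

Section Run.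
Variable p : baire.
Let x := unary p.

Let ready n t := rep k (run M p t) 0 (counter_state n) 0
  (actions p n).1 (actions p n).2.

(** Time 1, because the first step only places the marks. *)
Let ready0 : ready 0 1.
Proof.
have := init_rep k driver x; congr rep; apply: funext => i.
by rewrite /counter_state /upd; case: eqP.
Qed.

(** A round changes the output in a single step, so at each of its moments the tape is the one
    before or the one after the round. This carries eventual properties from rounds over to
    steps. *)
Let ready_out n t i o d cf pc rho :
  ready n t -> silent k driver x (run M p t) cf ->
  rep k cf pc rho 0 (actions p n).1 (actions p n).2 ->
  onth driver pc = Some (IOut o d) -> onth driver pc.+1 = Some (IJmp 0) ->
  i = A p n ->
  action i (actions p n) = (out_upd o (actions p n).2 (actions p n).1,
                            move_head d (actions p n).2) ->
  rho = counter_state n.+1 ->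
  exists2 t', t < t' & ready n.+1 t' /\
    forall s, t <= s <= t' -> cout (run M p s) = (actions p n).1 \/
      cout (run M p s) = (actions p n.+1).1.
Proof.
move=> rn [t1 [e1 sil]] rp f1 f2 ei ea er; exists (t1 + t).+2.
  by rewrite ltnS leqW // leq_addl.
have rp1 := step_rep x rp f1 isT.
rewrite -/(driver_machine) -/M in rp1.
have rp2 := step_rep x rp1 f2 isT.
rewrite -/(driver_machine) -/M /= in rp2.
have eo : (fun n0 : nat => out_upd o (actions p n).2 (actions p n).1 n0)
   = (actions p n.+1).1 by rewrite /= -ei ea.
split.
  rewrite /ready /run 2!iterS iterD e1 -/x.
  move: rp2; rewrite er; congr rep; last by rewrite /= -ei ea.
  by rewrite -eo; apply: funext => m; rewrite {1}/out_upd andbF.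
move=> s /andP[ts]; rewrite leq_eqVlt => /predU1P[->|].
  right; rewrite /run 2!iterS iterD e1 (rep_out rp2) -eo.
  by apply: funext => m; rewrite {1}/out_upd andbF.
rewrite ltnS leq_eqVlt => /predU1P[->|].
  by right; rewrite /run iterS iterD e1 (rep_out rp1) -eo.
rewrite ltnS => st; left.
rewrite -(subnK ts) /run iterD sil //; first exact: (rep_out rn).
by rewrite leq_subLR addnC.
Qed.

Let ready_next n t : ready n t -> exists2 t', t < t' & ready n.+1 t' /\
  forall s, t <= s <= t' -> cout (run M p s) = (actions p n).1 \/
    cout (run M p s) = (actions p n.+1).1.
Proof.
move=> rn; have ad : at_pc driver 0 driver by [].
have /at_pc_cat[ac] := ad; rewrite size_code add0n; set l := code_size c => at_.
have [cf0 s0 rp0] := silent_code driver_regs (cA p n) ac rn.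
rewrite add0n -/l in rp0.
have k3 : 2 < k by exact: leq_maxl.
have sym rho r : r < k ->
    nth 0 [seq nat_of_bool (rho j == 0) | j <- iota 0 k] r = (rho r == 0).
  by move=> rk; rewrite (nth_map 0) ?size_iota // nth_iota.
case/at_pc_cons: at_ => f0 /at_pc_cons[f1 /at_pc_cons[f2 /at_pc_cons[f3]]].
case/at_pc_cons=> f4 /at_pc_cons[f5 /at_pc_cons[f6 /at_pc_cons[f7]]].
case/at_pc_cons=> f8 /at_pc_cons[f9 /at_pc_cons[f10 _]].
have next i pc cf rho out op pc' : onth driver pc = Some i ->
    rep k cf pc rho 0 out op -> iout i = (None, Stay) -> iin i = Stay ->
    idst i pc (x 0) [seq nat_of_bool (rho j == 0) | j <- iota 0 k] = pc' ->
    exists2 cf', silent k driver x cf cf' & rep k cf' pc' (ireg_upd i rho) 0 out op.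
  move=> fe rp eo ei ed.
  by apply: (silent_step driver_regs rp fe) => //; rewrite ei.
have jz m pc (rho : nat -> nat) : idst (IJz 2 m) pc (x 0)
    [seq nat_of_bool (rho j == 0) | j <- iota 0 k] = if rho 2 == 0 then m else pc.+1.
  by rewrite /= sym //; case: (rho 2).
have [cf1 s1 rp1] := next _ _ _ _ _ _ _ f0 rp0 erefl erefl erefl.
have [cf2 s2 rp2] := next _ _ _ _ _ _ _ f1 rp1 erefl erefl (jz _ _ _).
have s02 := silent_trans (silent_trans s0 s1) s2.
have a2 := A2 p n.
have [a0|a0] := eqVneq (A p n) 0.
  rewrite a0 /= addnS in rp2.
  apply: (ready_out rn s02 rp2 (o := Some false) (d := GoRight) _ _ (esym a0)) => //.
  - by rewrite -f7 !addnS addn0.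
  - by rewrite -f8 !addnS addn0.
  by apply: funext => -[|[|[|j]]].
rewrite /= {1}/upd /= {1}/upd /= (negbTE a0) in rp2.
have [cf3 s3 rp3] := next _ _ _ _ _ _ _ f2 rp2 erefl erefl erefl.
have [cf4 s4 rp4] := next _ _ _ _ _ _ _ f3 rp3 erefl erefl (jz _ _ _).
have s04 := silent_trans (silent_trans s02 s3) s4.
have [a1|a1] := eqVneq (A p n) 1.
  rewrite a1 /= addnS in rp4.
  apply: (ready_out rn s04 rp4 (o := Some true) (d := GoRight) _ _ (esym a1)) => //.
  - by rewrite -f9 !addnS addn0.
  - by rewrite -f10 !addnS addn0.
  by apply: funext => -[|[|[|j]]].
have {a0 a1 a2} e2 : A p n = 2 by case: (A p n) a0 a1 a2 => [|[|[|a]]].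
rewrite e2 /= in rp4.
have [cf5 s5 rp5] := next _ _ _ _ _ _ _ f4 rp4 erefl erefl erefl.
have s05 := silent_trans s04 s5.
apply: (ready_out rn s05 rp5 f5 f6 (esym e2)).
  by rewrite /action /out_upd; congr pair; apply: funext => m; rewrite andbF.
by apply: funext => -[|[|[|j]]].
Qed.

Lemma driver_eventually (Q : (nat -> option bool) -> Prop) n0 :
  (forall n, n0 <= n -> Q (actions p n).1) ->
  exists t0, forall t, t0 <= t -> Q (cout (run M p t)).
Proof.
move=> Qn.
have [t0 r0] : exists t, ready n0 t.
  elim: n0 {Qn} => [|n [t /ready_next[t' _ [r' _]]]]; first by exists 1.
  by exists t'.
(* Each round takes at least one step, so round beginnings exist arbitrarily late, and [Q] holds
   throughout up to any of them. *)
exists t0 => t le; have /(_ (t - t0)) : forall m, exists t1 n,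
    [/\ t0 + m <= t1, n0 <= n, ready n t1 &
        forall s, t0 <= s <= t1 -> Q (cout (run M p s))].
  elim=> [|m [t1 [n [le1 len r1 Q1]]]].
    exists t0, n0; split; rewrite ?addn0 // => s.
    by rewrite -eqn_leq => /eqP <-; rewrite (rep_out r0); apply: Qn.
  have [t2 lt12 [r2 h2]] := ready_next r1; exists t2, n.+1; split=> //.
  - by rewrite addnS (leq_ltn_trans le1).
  - exact: leqW len.
  - move=> s /andP[s0 s2]; have [le_s1|lt_1s] := leqP s t1.
    by apply: Q1; rewrite s0.
  have [|->|->] := h2 s; first by rewrite (ltnW lt_1s).
    by apply: Qn.
  by apply: Qn; apply: leqW.
move=> [t1 [n [le1 _ _]]]; apply; rewrite le /=; apply: leq_trans le1.
by rewrite subnKC.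
Qed.

End Run.
End Driver.

(** * Primitive recursive functionals *)

Definition env2 (m a : nat) (e : nat -> nat) i :=
  match i with 0 => m | 1 => a | i.+2 => e i end.

Inductive pr : (baire -> (nat -> nat) -> nat) -> Prop :=
  | PrVar i : pr (fun _ e => e i)
  | PrZero : pr (fun _ _ => 0)
  | PrSucc f : pr f -> pr (fun p e => (f p e).+1)
  | PrInput f : pr f -> pr (fun p e => p (f p e))
  | PrComp f g : pr f -> (forall i, pr (g i)) ->
      pr (fun p e => f p (fun i => g i p e))
  | PrRec n a b : pr n -> pr a -> pr b ->
      pr (fun p e => nat_rect (fun=> nat) (a p e)
        (fun m acc => b p (env2 m acc e)) (n p e)).

Ltac upd_eq := apply: funext => j; rewrite /upd;
  repeat (case: eqP => ? //; try subst); try lia.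

(** * Loop rules and transfers between registers *)

Section Loops.
Variable x : nat -> bool.

(** [S m] and [I m] are the registers and the head position before round [m]; exhibiting them
    replaces an induction for each loop below. *)
Lemma exec_for r c n (S : nat -> nat -> nat) (I : nat -> nat) :
  (forall m, m < n -> 0 < S m r) ->
  (forall m, m < n -> exec x c (S m) (I m) (S m.+1) (I m.+1)) ->
  S n r = 0 -> exec x (While r c) (S 0) (I 0) (S n) (I n).
Proof.
elim: n S I => [|n IH] S I h1 h2 h0; first exact: ExWhile0.
apply: ExWhile (h2 0 isT) _; first exact: h1.
by apply: (IH (fun m => S m.+1) (fun m => I m.+1)) => // m mn; [exact: h1|exact: h2].
Qed.

Lemma exec_for_bit c n (S : nat -> nat -> nat) (I : nat -> nat) :
  (forall m, m < n -> x (I m)) ->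
  (forall m, m < n -> exec x c (S m) (I m) (S m.+1) (I m.+1)) ->
  x (I n) = false -> exec x (WhileBit c) (S 0) (I 0) (S n) (I n).
Proof.
elim: n S I => [|n IH] S I h1 h2 h0; first exact: ExWhileBit0.
apply: ExWhileBit (h2 0 isT) _; first exact: h1.
by apply: (IH (fun m => S m.+1) (fun m => I m.+1)) => // m mn; [exact: h1|exact: h2].
Qed.

Lemma exec_eq c rho i rho' i' rho2 i2 : exec x c rho i rho2 i2 ->
  rho2 = rho' -> i2 = i' -> exec x c rho i rho' i'.
Proof. by move=> + <- <-. Qed.

Definition clear r := While r (Dec r).

Lemma exec_clear r rho i : exec x (clear r) rho i (upd rho r 0) i.
Proof.
have := @exec_for r (Dec r) (rho r) (fun m => upd rho r (rho r - m)) (fun=> i).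
have -> : upd rho r (rho r - 0) = rho by upd_eq.
rewrite subnn; apply; rewrite /upd ?eqxx //.
  by move=> m; rewrite subn_gt0.
move=> m mr; apply: (exec_eq (ExDec _ _ _ _)) => //.
by upd_eq; rewrite subnS ?eqxx.
Qed.

Definition move r s := While r (Cat (Dec r) (Inc s)).

Lemma exec_move r s rho i : r != s ->
  exec x (move r s) rho i (upd (upd rho r 0) s (rho s + rho r)) i.
Proof.
move=> /eqP rs.
have := @exec_for r (Cat (Dec r) (Inc s)) (rho r)
  (fun m => upd (upd rho r (rho r - m)) s (rho s + m)) (fun=> i).
have -> : upd (upd rho r (rho r - 0)) s (rho s + 0) = rho by upd_eq.
rewrite subnn; apply.
- by move=> m mr; rewrite /upd; do 2?case: eqP => //; lia.
- move=> m mr; apply: ExCat (ExDec _ _ _ _) _.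
  by apply: (exec_eq (ExInc _ _ _ _)) => //; upd_eq.
- by rewrite /upd; do 2?case: eqP => //; lia.
Qed.

Definition copy r s t :=
  Cat (While r (Cat (Dec r) (Cat (Inc s) (Inc t)))) (move t r).

Lemma exec_copy r s t rho i : r != s -> s != t -> r != t -> rho s = 0 ->
  rho t = 0 -> exec x (copy r s t) rho i (upd rho s (rho r)) i.
Proof.
move=> /eqP rs /eqP st rt s0 t0.
apply: (@ExCat _ _ _ _ _ (upd (upd (upd rho r 0) s (rho r)) t (rho r)) i).
  have := @exec_for r (Cat (Dec r) (Cat (Inc s) (Inc t))) (rho r)
    (fun m => upd (upd (upd rho r (rho r - m)) s m) t m) (fun=> i).
  have -> : upd (upd (upd rho r (rho r - 0)) s 0) t 0 = rho by upd_eq.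
  move/eqP in rt; rewrite subnn; apply.
  - by move=> m mr; rewrite /upd; do 3?case: eqP => //; lia.
  - move=> m mr; apply: ExCat (ExDec _ _ _ _) _; apply: ExCat (ExInc _ _ _ _) _.
    by apply: (exec_eq (ExInc _ _ _ _)) => //; upd_eq.
  - by rewrite /upd; do 3?case: eqP => //; lia.
apply: (exec_eq (exec_move _ _ _)) => //; first by rewrite eq_sym.
by move/eqP in rt; upd_eq.
Qed.

End Loops.

(** * Register programs for primitive recursive functionals *)

Definition supported N (f : baire -> (nat -> nat) -> nat) :=
  forall p e e', (forall i, i < N -> e i = e' i) -> f p e = f p e'.

Definition implements (c : cmd) (f : baire -> (nat -> nat) -> nat) loc base :=
  forall p rho, (forall r, base <= r -> rho r = 0) ->
    exec (unary p) c rho 0 (upd rho base (f p (fun i => rho (loc i)))) 0.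

(* [f] looks up its [i]-th argument in register [loc i]; registers from [base] on
   are scratch, 0 at the beginning and, except for the result in [base], at the end. *)
Definition implementable N f := forall loc base,
  (forall i, i < N -> loc i < base) -> exists c, implements c f loc base.

(** The input can only be scanned: walk over as many blocks as the index says, then count the ones
    of the next block. Register [base.+1] records the distance walked, so that the head can return
    to cell 0. *)
Lemma implementable_input N f : implementable N f ->
  implementable N (fun p e => p (f p e)).
Proof.
move=> fN loc base lb; have [cf fP] := fN loc base lb.
pose step := Cat Fwd (Inc base.+1).
pose skip := Cat (Dec base) (Cat (WhileBit step) step).
exists (Cat cf (Cat (While base skip)
  (Cat (WhileBit (Cat (Inc base) step)) (While base.+1 (Cat Bwd (Dec base.+1)))))).
move=> p rho r0; apply: ExCat (fP p rho r0) _.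
set n := f p _; have b0 := r0 base (leqnn _); have b1 := r0 base.+1 (leqnSn _).
pose S m := upd (upd rho base (n - m)) base.+1 (block_start p m).
apply: (@ExCat _ _ _ _ _ (S n) (block_start p n)).
  have := @exec_for (unary p) base skip n S (block_start p).
  have -> : S 0 = upd rho base n.
    by rewrite /S /block_start big_ord0; upd_eq.
  have -> : block_start p 0 = 0 by rewrite /block_start big_ord0.
  apply.
  - by move=> m mn; rewrite /S /upd; do 2?case: eqP => //; lia.
  - move=> m mn; apply: ExCat (ExDec _ _ _ _) _.
    pose S' l := upd (upd rho base (n - m.+1)) base.+1 (block_start p m + l).
    have -> : upd (S m) base (S m base).-1 = S' 0 by rewrite /S /S'; upd_eq.
    apply: (@ExCat _ _ _ _ _ (S' (p m)) (block_start p m + p m)).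
      have := @exec_for_bit (unary p) step (p m) S' (fun l => block_start p m + l).
      rewrite addn0; apply.
      + by move=> l; exact: unary_one.
      + move=> l lp; apply: ExCat (ExFwd _ _ _) _; rewrite addnS.
        by apply: (exec_eq (ExInc _ _ _ _)) => //; rewrite /S'; upd_eq.
      + by rewrite -zero_posE unary_zero.
    rewrite block_startS zero_posE; apply: ExCat (ExFwd _ _ _) _.
    apply: (exec_eq (ExInc _ _ _ _)) => //.
    by rewrite /S' /S block_startS zero_posE; upd_eq.
  - by rewrite /S /upd; do 2?case: eqP => //; lia.
pose S1 l := upd (upd rho base l) base.+1 (block_start p n + l).
apply: (@ExCat _ _ _ _ _ (S1 (p n)) (block_start p n + p n)).
  have -> : S n = S1 0 by rewrite /S /S1; upd_eq.
  have := @exec_for_bit (unary p) (Cat (Inc base) step) (p n) S1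
    (fun l => block_start p n + l).
  rewrite addn0; apply.
  - by move=> l; exact: unary_one.
  - move=> l lp; apply: ExCat (ExInc _ _ _ _) _.
    apply: ExCat (ExFwd _ _ _) _; rewrite addnS.
    by apply: (exec_eq (ExInc _ _ _ _)) => //; rewrite /S1; upd_eq.
  - by rewrite -zero_posE unary_zero.
set N0 := block_start p n + p n.
pose S2 l := upd (upd rho base (p n)) base.+1 (N0 - l).
have := @exec_for (unary p) base.+1 (Cat Bwd (Dec base.+1)) N0 S2 (fun l => N0 - l).
have -> : S2 0 = S1 (p n) by rewrite /S2 /S1 -/N0; upd_eq.
have -> : S2 N0 = upd rho base (p n) by rewrite /S2; upd_eq.
rewrite subn0 subnn; apply.
- by move=> l lN; rewrite /S2 /upd eqxx; lia.
- move=> l lN; apply: ExCat (ExBwd _ _ _) _; rewrite -subnS.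
  by apply: (exec_eq (ExDec _ _ _ _)) => //; rewrite /S2; upd_eq.
- by rewrite /upd; case: eqP => //; lia.
Qed.

(** The arguments are collected in the registers from [base] to [base + N - 1], each computed with
    its scratch space above the earlier ones. Then [f] works from [base + N] on, the arguments are
    cleared and the result is moved down. *)
Lemma implementable_comp N M f (g : nat -> baire -> (nat -> nat) -> nat) :
  supported N f -> implementable N f ->
  (forall i, i < N -> supported M (g i)) ->
  (forall i, i < N -> implementable M (g i)) ->
  implementable M (fun p e => f p (fun i => g i p e)).
Proof.
move=> fs fN gs gN loc base lb.
have [cg gP] : exists c, forall p rho, (forall r, base <= r -> rho r = 0) ->
    exec (unary p) c rho 0 (fun r => if base <= r < base + N
      then g (r - base) p (fun i => rho (loc i)) else rho r) 0.
  have : N <= N by [].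
  elim: {-2}N => [|n IH] nN.
    exists Skip => p rho r0; apply: (exec_eq (ExSkip _ _ _)) => //.
    by apply: funext => r; case: ifP => //; lia.
  have [c cP] := IH (ltnW nN).
  have [|d dP] := gN n nN loc (base + n).
    by move=> i /lb /leq_trans; apply; apply: leq_addr.
  exists (Cat c d) => p rho r0; apply: ExCat (cP p rho r0) _.
  apply: (exec_eq (dP p _ _)) => // [r rb|].
    by case: ifP => [|_]; [lia|apply: r0; lia].
  apply: funext => r; rewrite /upd; case: eqP => [->|ne].
    have -> : base <= base + n < base + n.+1 by lia.
    rewrite addKn; apply: gs => // i iM; have := lb i iM.
    by case: ifP => //; lia.
  have -> : (base <= r < base + n.+1) = (base <= r < base + n) by lia.
  by [].
have [|cf fP] := fN (fun i => base + i) (base + N).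
  by move=> i; rewrite ltn_add2l.
have [cc ccP] : exists c, forall p rho, exec (unary p) c rho 0
    (fun r => if base <= r < base + N then 0 else rho r) 0.
  elim: (N) => [|n [c cP]].
    exists Skip => p rho; apply: (exec_eq (ExSkip _ _ _)) => //.
    by apply: funext => r; case: ifP => //; lia.
  exists (Cat c (clear (base + n))) => p rho; apply: ExCat (cP p rho) _.
  apply: (exec_eq (exec_clear _ _ _ _)) => //; apply: funext => r; rewrite /upd.
  have -> : (base <= r < base + n.+1) = (base <= r < base + n) || (r == base + n).
    by lia.
  by case: (r == _); rewrite ?orbT ?orbF.
have [m mP] : exists c, forall p rho, (0 < N -> rho base = 0) ->
    exec (unary p) c rho 0
    (upd (if N == 0 then rho else upd rho (base + N) 0) base (rho (base + N))) 0.
  (* Without arguments the result already lies in [base], and moving a nonzero register to itself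
     would not terminate. *)
  have [->|N0] := eqVneq N 0.
    exists Skip => p rho _; apply: (exec_eq (ExSkip _ _ _)) => //.
    by rewrite addn0; upd_eq.
  exists (move (base + N) base) => p rho b0.
  have b0' : rho base = 0 by apply: b0; lia.
  apply: (exec_eq (@exec_move _ _ _ _ _ _)) => //; first by lia.
  by rewrite b0' add0n.
exists (Cat cg (Cat cf (Cat cc m))) => p rho r0.
apply: ExCat (gP p rho r0) _.
apply: ExCat (fP p _ _) _ => [r rb|].
  by case: ifP => [|_]; [lia|apply: r0; lia].
apply: ExCat (ccP p _) _.
apply: (exec_eq (mP p _ _)) => //.
  by move=> N0; case: ifP => //; lia.
set v := f p _; have -> : f p (fun i => g i p (fun i0 => rho (loc i0))) = v.
  apply: fs => i iN; have -> : base <= base + i < base + N by lia.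
  by rewrite addKn.
have b0 := r0 base (leqnn _); have bN0 := r0 (base + N) (leq_addr _ _).
have -> : (base <= base + N < base + N) = false by lia.
have updE h r w : upd h r w r = w by rewrite /upd eqxx.
rewrite updE; case: (eqVneq N 0) => [N0|N0].
  by rewrite N0 addn0; apply: funext => r; rewrite /upd; case: eqP => // rb;
    do 2?case: ifP => //; lia.
apply: funext => r; rewrite /upd; case: eqP => // rb.
case: eqP => [->|rN]; first by rewrite bN0.
case: ifP => h; first by rewrite r0 //; lia.
by rewrite h.
Qed.

(** Layout: [base] counts the remaining rounds down, [base.+1] holds the recursion index, [base.+2]
    the accumulator and [base.+3] its next value. *)
Lemma implementable_rec N n a b :
  supported N n -> implementable N n -> supported N a -> implementable N a ->
  supported N.+2 b -> implementable N.+2 b ->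
  implementable N (fun p e => nat_rect (fun=> nat) (a p e)
        (fun m acc => b p (env2 m acc e)) (n p e)).
Proof.
move=> sn Nn sa Na sb Nb loc base lb.
have [cn nP] := Nn loc base lb.
have [|ca aP] := Na loc base.+2; first by move=> i /lb; lia.
pose loc' i := match i with 0 => base.+1 | 1 => base.+2 | i.+2 => loc i end.
have [|cb bP] := Nb loc' base.+3.
  by move=> [|[|i]] //=; rewrite !ltnS => /lb; lia.
pose body := Cat (Dec base) (Cat cb (Cat (clear base.+2)
  (Cat (move base.+3 base.+2) (Inc base.+1)))).
exists (Cat cn (Cat ca (Cat (While base body)
  (Cat (clear base.+1) (move base.+2 base))))) => p rho r0.
have b0 := r0 base (leqnn _); have b1 : rho base.+1 = 0 by apply: r0; lia.
have b2 : rho base.+2 = 0 by apply: r0; lia.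
have b3 : rho base.+3 = 0 by apply: r0; lia.
apply: ExCat (nP p rho r0) _; set k := n p _.
apply: ExCat (aP p _ _) _.
  by move=> r rb; rewrite /upd; case: eqP => [?|_]; [lia|apply: r0; lia].
set e := fun i => rho (loc i).
have -> : a p (fun i => upd rho base k (loc i)) = a p e.
  by apply: sa => i iN; rewrite /upd /e; case: eqP => // h; have := lb i iN; lia.
pose R := nat_rect (fun=> nat) (a p e) (fun m acc => b p (env2 m acc e)).
pose S m := upd (upd (upd rho base (k - m)) base.+1 m) base.+2 (R m).
have -> : upd (upd rho base k) base.+2 (a p e) = S 0 by rewrite /S; upd_eq.
apply: (@ExCat _ _ _ _ _ (S k) 0).
  have := @exec_for (unary p) base body k S (fun=> 0); apply.
  - by move=> m mk; rewrite /S /upd; do 3?case: eqP => //; lia.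
  - move=> m mk; apply: ExCat (ExDec _ _ _ _) _.
    pose S' v2 v3 := upd (upd (upd (upd rho base (k - m.+1)) base.+1 m) base.+2 v2)
      base.+3 v3.
    have -> : upd (S m) base (S m base).-1 = S' (R m) 0 by rewrite /S /S'; upd_eq.
    apply: (@ExCat _ _ _ _ _ (S' (R m) (R m.+1)) 0).
      apply: (exec_eq (bP p _ _)) => //.
        by move=> r rb; rewrite /S' /upd; do 4?(case: eqP => [?|_]; first lia);
          apply: r0; lia.
      have -> : b p (fun i => S' (R m) 0 (loc' i)) = R m.+1.
        apply: sb => -[_|[_|i]] /=.
        + by rewrite /S' /upd; do 4?case: eqP => //; lia.
        + by rewrite /S' /upd; do 4?case: eqP => //; lia.
        rewrite !ltnS /e => /lb h.
        by rewrite /S' /upd; do 4?(case: eqP => [?|_]; first lia).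
      by rewrite /S'; upd_eq.
    apply: ExCat (exec_clear _ _ _ _) _.
    apply: ExCat (exec_move _ _ _ _) _; first by lia.
    apply: (exec_eq (ExInc _ _ _ _)) => //.
    by rewrite /S /S'; upd_eq.
  - by rewrite /S /upd; do 3?case: eqP => //; lia.
apply: ExCat (exec_clear _ _ _ _) _.
apply: (exec_eq (exec_move _ _ _ _)) => //; first by lia.
by rewrite /S -/R; upd_eq.
Qed.

Lemma supported_le N M f : N <= M -> supported N f -> supported M f.
Proof.
by move=> NM h p e e' ee; apply: h => i iN; apply: ee; apply: leq_trans NM.
Qed.

Lemma implementable_le N M f : N <= M -> implementable N f -> implementable M f.
Proof.
by move=> NM h loc base lb; apply: h => i iN; apply: lb; apply: leq_trans NM.
Qed.

Lemma pr_implementable f : pr f -> exists N, supported N f /\ implementable N f.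
Proof.
elim=> {f}.
- move=> i; exists i.+1; split=> [p e e' ee|loc base lb]; first exact: ee.
  exists (copy (loc i) base base.+1) => p rho r0.
  have h := lb i (ltnSn i).
  by apply: exec_copy; rewrite ?r0 //; lia.
- exists 0; split=> // loc base _; exists Skip => p rho r0.
  apply: (exec_eq (ExSkip _ _ _)) => //; have b0 := r0 base (leqnn _).
  by upd_eq.
- move=> f _ [N [sf Nf]]; exists N; split=> [p e e' /sf -> //|loc base lb].
  have [c cP] := Nf loc base lb; exists (Cat c (Inc base)) => p rho r0.
  apply: ExCat (cP p rho r0) _; apply: (exec_eq (ExInc _ _ _ _)) => //.
  by upd_eq.
- move=> f _ [N [sf Nf]]; exists N; split=> [p e e' /sf -> //|].
  exact: implementable_input.
- move=> f g _ [N [sf Nf]] _ IH.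
  (* Only the [N] members of the family that [f] reads need a common bound. *)
  have [M gM] : exists M, forall i, i < N -> supported M (g i) /\ implementable M (g i).
    elim: (N) => [|n [M gM]]; first by exists 0.
    have [K [gK1 gK2]] := IH n; exists (maxn M K) => i.
    rewrite ltnS leq_eqVlt => /predU1P[->|/gM[h1 h2]]; split.
    - apply: supported_le gK1; exact: leq_maxr.
    - apply: implementable_le gK2; exact: leq_maxr.
    - apply: supported_le h1; exact: leq_maxl.
    - apply: implementable_le h2; exact: leq_maxl.
  exists M; split; last by apply: implementable_comp sf Nf _ _ => i /gM[].
  by move=> p e e' ee; apply: sf => i /gM[h _]; apply: h.
- move=> n a b _ [Nn [sn In]] _ [Na [sa Ia]] _ [Nb [sb Ib]].
  pose N := maxn Nn (maxn Na Nb).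
  have [ln la lb] : [/\ Nn <= N, Na <= N & Nb <= N.+2] by split; lia.
  have {}sn := supported_le ln sn; have {}sa := supported_le la sa.
  have {}sb := supported_le lb sb.
  exists N; split; last first.
    apply: implementable_rec => //; [exact: implementable_le ln In|
      exact: implementable_le la Ia|exact: implementable_le lb Ib].
  move=> p e e' ee; rewrite (sn p e e' ee); elim: (n p e') => [|k IH] /=.
    exact: sa.
  by apply: sb => -[|[|i]] //= /ee.
Qed.

Theorem pr_machine two_way A : pr (fun p e => A p (e 0)) ->
  (forall p n, A p n <= 2) ->
  exists2 M, ~~ two_way -> one_way M & forall p (Q : (nat -> option bool) -> Prop) n0,
    (forall n, n0 <= n -> Q (actions two_way A p n).1) ->
    exists t0, forall t, t0 <= t -> Q (cout (run M p t)).
Proof.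
move=> /pr_implementable[N [_ NA]] A2.
(* Read as a number, [i != 0] puts variable 0 into register 0 and all others into register 1, which
   stays 0; the result appears in register 2, as the driver expects. *)
have [|c cP] := NA (fun i => i != 0) 2; first by case.
have cA p n : exec (unary p) c (counter_state n) 0
    (upd (counter_state n) 2 (A p n)) 0.
  by apply: (exec_eq (cP p _ _)) => // -[].
exists (driver_machine two_way c); first exact: driver_one_way.
by move=> p Q n0; apply: driver_eventually.
Qed.

(** * Arithmetic of codes *)

Lemma pr_ext f g : pr f -> (forall p e, f p e = g p e) -> pr g.
Proof.
by move=> h fg; have <- : f = g by apply: funext => p; apply: funext => e.
Qed.

Lemma pr_sub1 F a : pr (fun p e => F p (e 0)) -> pr a -> pr (fun p e => F p (a p e)).
Proof. by move=> hF ha; apply: (PrComp (g := fun=> a) hF). Qed.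

Lemma pr_sub2 F a b : pr (fun p e => F p (e 0) (e 1)) -> pr a -> pr b ->
  pr (fun p e => F p (a p e) (b p e)).
Proof.
move=> hF ha hb.
by apply: (PrComp (g := fun i => if i is 0 then a else b) hF); case.
Qed.

Lemma pr_sub3 F a b c : pr (fun p e => F p (e 0) (e 1) (e 2)) ->
  pr a -> pr b -> pr c -> pr (fun p e => F p (a p e) (b p e) (c p e)).
Proof.
move=> hF ha hb hc.
by apply: (PrComp (g := fun i => match i with 0 => a | 1 => b | _ => c end) hF);
  case=> [|[]].
Qed.

Lemma pr_const c : pr (fun _ _ => c).
Proof. by elim: c => [|c]; [exact: PrZero|exact: PrSucc]. Qed.

Lemma pr_add a b : pr a -> pr b -> pr (fun p e => a p e + b p e).
Proof.
apply: (@pr_sub2 (fun _ x y => x + y)).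
apply: (pr_ext (PrRec (PrVar 0) (PrVar 1) (PrSucc (PrVar 1)))) => p e.
by elim: (e 0) => //= n ->.
Qed.

Lemma pr_pred a : pr a -> pr (fun p e => (a p e).-1).
Proof.
apply: (@pr_sub1 (fun _ x => x.-1)).
by apply: (pr_ext (PrRec (PrVar 0) PrZero (PrVar 0))) => p e; case: (e 0).
Qed.

Lemma pr_sub a b : pr a -> pr b -> pr (fun p e => a p e - b p e).
Proof.
apply: (@pr_sub2 (fun _ x y => x - y)).
apply: (pr_ext (PrRec (PrVar 1) (PrVar 0) (pr_pred (PrVar 1)))) => p e.
by elim: (e 1) => [|n /= ->]; rewrite ?subn0 // subnS.
Qed.

Lemma pr_odd a : pr a -> pr (fun p e => nat_of_bool (odd (a p e))).
Proof.
apply: (@pr_sub1 (fun _ x => nat_of_bool (odd x))).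
apply: (pr_ext (PrRec (PrVar 0) PrZero (pr_sub (pr_const 1) (PrVar 1)))) => p e.
by elim: (e 0) => //= n ->; case: odd.
Qed.

Lemma pr_half a : pr a -> pr (fun p e => (a p e)./2).
Proof.
apply: (@pr_sub1 (fun _ x => x./2)).
apply: (pr_ext (PrRec (PrVar 0) PrZero (pr_add (pr_odd (PrVar 0)) (PrVar 1)))) => p e.
by elim: (e 0) => //= n ->; rewrite uphalf_half.
Qed.

Lemma pr_iter F n a : (forall b, pr b -> pr (fun p e => F (b p e))) -> pr n -> pr a ->
  pr (fun p e => iter (n p e) F (a p e)).
Proof.
move=> hF; apply: (@pr_sub2 (fun _ x y => iter x F y)).
apply: (pr_ext (PrRec (PrVar 0) (PrVar 1) (hF _ (PrVar 1)))) => p e.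
by elim: (e 0) => //= k ->.
Qed.

(* One step of [CodeSeq.code]: the head is the 2-adic valuation, which
   [code_head] finds by bounded search. *)
Definition code_cons x c := 2 ^ x * c.*2.+1.

Lemma pr_cons a b : pr a -> pr b -> pr (fun p e => code_cons (a p e) (b p e)).
Proof.
apply: (@pr_sub2 (fun _ x y => code_cons x y)).
have h b' : pr b' -> pr (fun p e => (b' p e).*2).
  by move=> hb; apply: (pr_ext (pr_add hb hb)) => p e; rewrite addnn.
apply: (pr_ext (pr_iter h (PrVar 0) (PrSucc (h _ (PrVar 1))))) => p e.
rewrite /code_cons; elim: (e 0) => [|n /= ->]; first by rewrite mul1n.
by rewrite expnS -mul2n mulnA.
Qed.

Definition code_head c := nat_rect (fun=> nat) 0
  (fun m acc => acc + (1 - ((m - acc) + odd (iter m half c)))) c.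
Definition code_tail c := (iter (code_head c) half c)./2.

Lemma iter_half_cons x c k :
  k <= x -> iter k half (code_cons x c) = code_cons (x - k) c.
Proof.
elim: k => [|k IH] kx; first by rewrite subn0.
rewrite iterS IH 1?ltnW // /code_cons.
have -> : x - k = (x - k.+1).+1 by lia.
by rewrite expnS -mulnA mul2n doubleK.
Qed.

Lemma code_cons_gt x c : x < code_cons x c.
Proof.
apply: (@leq_trans (2 ^ x)); first exact: ltn_expl.
by rewrite -{1}(muln1 (2 ^ x)) leq_mul2l orbT.
Qed.

Lemma code_headK x c : code_head (code_cons x c) = x.
Proof.
rewrite /code_head; set n := code_cons x c.
have h k : nat_rect (fun=> nat) 0
    (fun m acc => acc + (1 - ((m - acc) + odd (iter m half n)))) k = minn k x.
  elim: k => [|k /= ->]; first by rewrite min0n.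
  have [kx|kx|->] := ltngtP k x; last 2 first.
  - by lia.
  - by rewrite /n iter_half_cons // subnn /code_cons mul1n /= odd_double; lia.
  rewrite iter_half_cons 1?ltnW //.
  have -> : x - k = (x - k.+1).+1 by lia.
  by rewrite /code_cons expnS -mulnA mul2n odd_double; lia.
(* The search runs for as many rounds as the code says, and a code exceeds its head. *)
by rewrite h; apply/minn_idPr/ltnW/code_cons_gt.
Qed.

Lemma code_tailK x c : code_tail (code_cons x c) = c.
Proof.
by rewrite /code_tail code_headK iter_half_cons // subnn /code_cons mul1n
  (half_bit_double c true).
Qed.

Lemma pr_head a : pr a -> pr (fun p e => code_head (a p e)).
Proof.
apply: (@pr_sub1 (fun _ x => code_head x)).
by apply: (pr_ext (PrRec (PrVar 0) PrZero (pr_add (PrVar 1) (pr_sub (pr_const 1)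
  (pr_add (pr_sub (PrVar 0) (PrVar 1))
     (pr_odd (pr_iter pr_half (PrVar 0) (PrVar 2)))))))) => p e.
Qed.

Lemma pr_tail a : pr a -> pr (fun p e => code_tail (a p e)).
Proof. by move=> ha; apply/pr_half/(pr_iter pr_half) => //; apply: pr_head. Qed.

Lemma pr_ifz a b c : pr a -> pr b -> pr c ->
  pr (fun p e => if a p e == 0 then b p e else c p e).
Proof.
apply: (@pr_sub3 (fun _ x y z => if x == 0 then y else z)).
(* Inside the recursion two variables are pushed, so [PrVar 4] is the third argument. *)
by apply: (pr_ext (PrRec (PrVar 0) (PrVar 1) (PrVar 4))) => p e; case: (e 0).
Qed.

(** * Primitive recursive functionals on countable types *)

(** Tracking on codes: what [g] does to numbers that code nothing is irrelevant. Algorithms can thus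
    be written on typed data and still be compiled. *)
Definition pc (X Y : countType) (f : baire -> X -> Y) :=
  exists2 g, pr g & forall p x e, e 0 = pickle x -> g p e = pickle (f p x).

Section Closure.
Variable X : countType.

Lemma pc_id : pc (fun _ (x : X) => x).
Proof. by exists (fun _ e => e 0); [exact: PrVar|]. Qed.

Lemma pc_const (Y : countType) (y : Y) : pc (fun _ (_ : X) => y).
Proof. by exists (fun _ _ => pickle y); [exact: pr_const|]. Qed.

Lemma pc_comp (Y Z : countType) (f : baire -> Y -> Z) (g : baire -> X -> Y) :
  pc f -> pc g -> pc (fun p x => f p (g p x)).
Proof.
move=> [f' f1 f2] [g' g1 g2]; exists (fun p e => f' p (fun _ => g' p e)).
  exact: (PrComp (g := fun=> g')).
by move=> p x e ex; apply/f2/g2.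
Qed.

Lemma pc_intro1 (Y Z : countType) (F : Y -> Z) (G : nat -> nat) :
  (forall a, pr a -> pr (fun p e => G (a p e))) ->
  (forall y, G (pickle y) = pickle (F y)) ->
  forall a : baire -> X -> Y, pc a -> pc (fun p x => F (a p x)).
Proof.
move=> hG FG a [a' a1 a2]; exists (fun p e => G (a' p e)); first exact: hG.
by move=> p x e ex; rewrite (a2 _ x) // FG.
Qed.

Lemma pc_intro2 (Y1 Y2 Z : countType) (F : Y1 -> Y2 -> Z) (G : nat -> nat -> nat) :
  (forall a b, pr a -> pr b -> pr (fun p e => G (a p e) (b p e))) ->
  (forall y1 y2, G (pickle y1) (pickle y2) = pickle (F y1 y2)) ->
  forall (a : baire -> X -> Y1) (b : baire -> X -> Y2),
  pc a -> pc b -> pc (fun p x => F (a p x) (b p x)).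
Proof.
move=> hG FG a b [a' a1 a2] [b' b1 b2].
exists (fun p e => G (a' p e) (b' p e)); first exact: hG.
by move=> p x e ex; rewrite (a2 _ x) // (b2 _ x) // FG.
Qed.

Lemma pickle_pair (Y Z : countType) (y : Y) (z : Z) :
  pickle (y, z) = code_cons (pickle y) (code_cons (pickle z) 0).
Proof. by []. Qed.

Lemma pickle_cons (Y : countType) (y : Y) s :
  pickle (y :: s) = code_cons (pickle y) (pickle s).
Proof. by []. Qed.

Lemma pc_pair (Y Z : countType) (a : baire -> X -> Y) (b : baire -> X -> Z) :
  pc a -> pc b -> pc (fun p x => (a p x, b p x)).
Proof.
apply: (@pc_intro2 Y Z _ pair (fun x y => code_cons x (code_cons y 0))) => //.
by move=> a' b' ha hb; apply: pr_cons => //; apply: pr_cons => //; exact: PrZero.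
Qed.

Lemma pc_fst (Y Z : countType) (a : baire -> X -> Y * Z) :
  pc a -> pc (fun p x => (a p x).1).
Proof.
apply: (@pc_intro1 (Y * Z)%type Y fst code_head) => [|[y z]]; first exact: pr_head.
by rewrite pickle_pair code_headK.
Qed.

Lemma pc_snd (Y Z : countType) (a : baire -> X -> Y * Z) :
  pc a -> pc (fun p x => (a p x).2).
Proof.
apply: (@pc_intro1 (Y * Z)%type Z snd (fun c => code_head (code_tail c))).
  by move=> a' ha; apply/pr_head/pr_tail.
by move=> [y z]; rewrite pickle_pair code_tailK code_headK.
Qed.

Lemma pc_rec (Y : countType) n a (h : baire -> X * nat * Y -> Y) :
  pc n -> pc a -> pc h ->
  pc (fun p (x : X) => nat_rect (fun=> Y) (a p x) (fun m acc => h p (x, m, acc)) (n p x)).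
Proof.
move=> [n' n1 n2] [a' a1 a2] [h' h1 h2].
pose pairc x y := code_cons x (code_cons y 0).
have prp u v : pr u -> pr v -> pr (fun p e => pairc (u p e) (v p e)).
  by move=> ha hb; apply: pr_cons => //; apply: pr_cons => //; exact: PrZero.
exists (fun p e => nat_rect (fun=> nat) (a' p e) (fun m acc =>
   h' p (fun=> pairc (pairc (e 0) m) acc)) (n' p e)).
  apply: pr_ext (PrRec n1 a1 (PrComp (g := fun=> _) h1
    (fun=> prp _ _ (prp _ _ (PrVar 2) (PrVar 0)) (PrVar 1)))) _ => p e.
  by [].
move=> p x e ex; rewrite (n2 _ x) // (a2 _ x) //.
rewrite [pickle (n p x)]/=; elim: (n p x) => //= m ->.
by apply: h2; rewrite !pickle_pair ex.
Qed.

Lemma pc_succ a : pc a -> pc (fun p (x : X) => (a p x).+1).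
Proof. by apply: (@pc_intro1 nat nat succn succn) => // b; exact: PrSucc. Qed.

Lemma pc_input a : pc a -> pc (fun p (x : X) => p (a p x)).
Proof.
move=> [a' a1 a2]; exists (fun p e => p (a' p e)); first exact: PrInput.
by move=> p x e ex; rewrite (a2 _ x).
Qed.

Lemma pc_pickle (Y : countType) (a : baire -> X -> Y) :
  pc a -> pc (fun p (x : X) => pickle (a p x)).
Proof. by case=> g g1 g2; exists g. Qed.

Lemma pc_add a b : pc a -> pc b -> pc (fun p (x : X) => a p x + b p x).
Proof. by apply: (@pc_intro2 nat nat nat addn addn) => //; exact: pr_add. Qed.

Lemma pc_sub a b : pc a -> pc b -> pc (fun p (x : X) => a p x - b p x).
Proof. by apply: (@pc_intro2 nat nat nat subn subn) => //; exact: pr_sub. Qed.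

Lemma pc_pred a : pc a -> pc (fun p (x : X) => (a p x).-1).
Proof. by apply: (@pc_intro1 nat nat predn predn) => // b; exact: pr_pred. Qed.

Lemma pc_odd a : pc a -> pc (fun p (x : X) => odd (a p x)).
Proof.
by apply: (@pc_intro1 nat bool odd (fun n => nat_of_bool (odd n))) => // b;
  exact: pr_odd.
Qed.

Lemma pc_half a : pc a -> pc (fun p (x : X) => (a p x)./2).
Proof. by apply: (@pc_intro1 nat nat half half) => // b; exact: pr_half. Qed.

Lemma pc_if (Y : countType) (c : baire -> X -> bool) (a b : baire -> X -> Y) :
  pc c -> pc a -> pc b -> pc (fun p x => if c p x then a p x else b p x).
Proof.
move=> [c' c1 c2] [a' a1 a2] [b' b1 b2].
exists (fun p e => if c' p e == 0 then b' p e else a' p e); first exact: pr_ifz.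
move=> p x e ex; rewrite (c2 _ x) // (a2 _ x) // (b2 _ x) //.
by case: (c p x).
Qed.

Lemma pc_eq (Y : countType) (a b : baire -> X -> Y) :
  pc a -> pc b -> pc (fun p x => a p x == b p x).
Proof.
apply: (@pc_intro2 Y Y bool (fun u v => u == v) (fun u v => 1 - ((u - v) + (v - u)))).
  by move=> u v hu hv; apply: pr_sub; [exact: pr_const|apply: pr_add; exact: pr_sub].
move=> u v; rewrite -(inj_eq (pcan_inj pickleK)) [RHS]/=.
rewrite -[RHS]/(nat_of_bool _).
by case: (eqVneq (pickle u)) => h; lia.
Qed.

Lemma pc_nat (a : baire -> X -> bool) : pc a -> pc (fun p x => nat_of_bool (a p x)).
Proof. by case=> g g1 g2; exists g. Qed.

Lemma pc_neg (a : baire -> X -> bool) : pc a -> pc (fun p x => ~~ a p x).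
Proof.
move=> ha; have -> : (fun p x => ~~ a p x) = (fun p x => if a p x then false else true).
  by apply: funext => p; apply: funext => x; case: (a p x).
by apply: pc_if => //; exact: pc_const.
Qed.

Lemma pc_and (a b : baire -> X -> bool) : pc a -> pc b -> pc (fun p x => a p x && b p x).
Proof. by move=> ha hb; apply: pc_if => //; exact: pc_const. Qed.

Lemma pc_leq a b : pc a -> pc b -> pc (fun p (x : X) => a p x <= b p x).
Proof.
by move=> ha hb; apply: pc_eq; [exact: pc_sub|exact: pc_const].
Qed.

End Closure.

Lemma pc_app2 (X : countType) (Y1 Y2 Z : countType) (F : baire -> Y1 -> Y2 -> Z) :
  pc (fun p y => F p y.1 y.2) -> forall (a : baire -> X -> Y1) (b : baire -> X -> Y2),
  pc a -> pc b -> pc (fun p x => F p (a p x) (b p x)).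
Proof. by move=> hF a b ha hb; exact: (pc_comp hF (pc_pair ha hb)). Qed.

Lemma pc_nat_rect (X Y : countType) n (a : baire -> X -> Y) h :
  pc n -> pc a -> pc (fun p (y : X * nat * Y) => h p y.1.1 y.1.2 y.2) ->
  pc (fun p x => nat_rect (fun=> Y) (a p x) (fun m acc => h p x m acc) (n p x)).
Proof. by move=> hn ha hh; exact: pc_rec hn ha hh. Qed.

Lemma pc_iter (X Y : countType) n (a : baire -> X -> Y) h :
  pc n -> pc a -> pc (fun p (y : X * Y) => h p y.1 y.2) ->
  pc (fun p x => iter (n p x) (h p x) (a p x)).
Proof.
move=> hn ha hh.
have -> : (fun p x => iter (n p x) (h p x) (a p x)) =
    fun p x => nat_rect (fun=> Y) (a p x) (fun _ acc => h p x acc) (n p x).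
  by apply: funext => p; apply: funext => x; elim: (n p x) => //= k ->.
apply: pc_nat_rect hn ha _.
by apply: (pc_app2 hh); [exact/pc_fst/pc_fst/pc_id|exact/pc_snd/pc_id].
Qed.

Lemma pc_ext (X Y : countType) (f g : baire -> X -> Y) :
  pc f -> (forall p x, f p x = g p x) -> pc g.
Proof.
by move=> h fg; have <- : f = g by apply: funext => p; apply: funext => x.
Qed.

Ltac pc_hyp := match goal with
  | H : pc ?f |- pc (fun p y => ?f p (@?g p y)) => apply: (pc_comp H)
  | H : pc (fun p y => ?F p y.1 y.2) |- pc (fun p z => ?F p (@?a p z) (@?b p z)) =>
      apply: (pc_app2 H)
  end.

Ltac pc_extra := fail.

Ltac pc_head := lazymatch goal with
  | |- pc (fun p x => fst (@?a p x)) => refine (pc_fst _)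
  | |- pc (fun p x => snd (@?a p x)) => refine (pc_snd _)
  | |- pc (fun p x => (@?a p x, @?b p x)) => refine (pc_pair _ _)
  | |- pc (fun p x => nat_of_bool (@?a p x)) => refine (pc_nat _)
  | |- pc (fun p x => (@?a p x).+1) => refine (pc_succ _)
  | |- pc (fun p x => (@?a p x).-1) => refine (pc_pred _)
  | |- pc (fun p x => @?a p x + @?b p x) => refine (pc_add _ _)
  | |- pc (fun p x => @?a p x - @?b p x) => refine (pc_sub _ _)
  | |- pc (fun p x => odd (@?a p x)) => refine (pc_odd _)
  | |- pc (fun p x => (@?a p x)./2) => refine (pc_half _)
  | |- pc (fun p x => @?a p x <= @?b p x) => refine (pc_leq _ _)
  | |- pc (fun p x => @?a p x == @?b p x) => refine (pc_eq _ _)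
  | |- pc (fun p x => ~~ (@?a p x)) => refine (pc_neg _)
  | |- pc (fun p x => @?a p x && @?b p x) => refine (pc_and _ _)
  | |- pc (fun p x => if _ then _ else _) => refine (pc_if _ _ _)
  | |- pc (fun p x => pickle (@?a p x)) => refine (pc_pickle _)
  | |- pc (fun p x => nat_rect _ _ _ _) => refine (pc_nat_rect _ _ _)
  | |- pc (fun p x => iter _ _ _) => refine (pc_iter _ _ _)
  | _ => pc_extra
  end.

Ltac pcs := repeat (cbv beta; first [assumption | exact: pc_id | exact: pc_const
  | pc_hyp | pc_head]).

(** * Bounded operations, options and lists *)

Lemma pc_mul (X : countType) a b : pc a -> pc b -> pc (fun p (x : X) => a p x * b p x).
Proof.
move=> ha hb; apply: (@pc_ext X nat
  (fun p x => nat_rect (fun=> nat) 0 (fun _ acc => acc + b p x) (a p x))); first by pcs.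
by move=> p x; elim: (a p x) => //= n ->; rewrite mulSn addnC.
Qed.

Lemma pc_exp2 (X : countType) a : pc a -> pc (fun p (x : X) => 2 ^ a p x).
Proof.
move=> ha; apply: (@pc_ext X nat
  (fun p x => nat_rect (fun=> nat) 1 (fun _ acc => acc + acc) (a p x))); first by pcs.
by move=> p x; elim: (a p x) => //= n ->; rewrite expnS mul2n addnn.
Qed.

Lemma pc_sum (X : countType) n h : pc n -> pc (fun p (y : X * nat) => h p y.1 y.2) ->
  pc (fun p x => \sum_(i < n p x) h p x i).
Proof.
move=> hn hh; apply: (@pc_ext X nat
  (fun p x => nat_rect (fun=> nat) 0 (fun i acc => acc + h p x i) (n p x))); first by pcs.
move=> p x; elim: (n p x) => [|k /= ->]; first by rewrite big_ord0.
by rewrite big_ord_recr.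
Qed.

Lemma pc_forall (X : countType) n h :
  pc n -> pc (fun p (y : X * nat) => h p y.1 y.2) ->
  pc (fun p x => [forall i : 'I_(n p x), h p x i]).
Proof.
move=> hn hh; apply: (@pc_ext X bool
  (fun p x => nat_rect (fun=> bool) true (fun i acc => acc && h p x i) (n p x))).
  by pcs.
move=> p x; elim: (n p x) => [|k /= ->]; first by apply/esym/forallP; case.
apply/andP/forallP => [[/forallP h1 h2] i|h1].
  have [e|ne] := eqVneq (i : nat) k; first by rewrite e.
  have ik : i < k by rewrite ltn_neqAle ne -ltnS ltn_ord.
  exact: (h1 (Ordinal ik)).
split; last exact: (h1 ord_max).
by apply/forallP => i; exact: (h1 (widen_ord (leqnSn k) i)).
Qed.

Lemma pc_some (X Y : countType) (a : baire -> X -> Y) :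
  pc a -> pc (fun p x => Some (a p x)).
Proof.
apply: (@pc_intro1 X Y (option Y) Some (fun u => code_cons u 0)) => // u hu.
by apply: pr_cons => //; exact: PrZero.
Qed.

(** An option is coded like a list of length at most 1: code 0 is [None], and the head of any other
    code is the content. *)
Lemma pc_match (X Y Z : countType) (o : baire -> X -> option Y)
    (d : baire -> X -> Z) h :
  pc o -> pc d -> pc (fun p (y : X * Y) => h p y.1 y.2) ->
  pc (fun p x => if o p x is Some y then h p x y else d p x).
Proof.
move=> [t t1 t2] [d' d1 d2] [h' h1 h2].
pose pairc x y := code_cons x (code_cons y 0).
exists (fun p e => if t p e == 0 then d' p e else
   h' p (fun _ => pairc (e 0) (code_head (t p e)))).
  apply: pr_ifz => //; apply: (PrComp (g := fun=> _) h1) => _; apply: pr_cons.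
    exact: PrVar.
  by apply: pr_cons; [exact: pr_head|exact: PrZero].
move=> p x e ex; rewrite (t2 _ x) // (d2 _ x) //; case: (o p x) => [y|] //.
have -> : pickle (Some y) = code_cons (pickle y) 0 by [].
rewrite code_headK ifF; last by case: code_cons (code_cons_gt (pickle y) 0).
by apply: (h2 p (x, y)); rewrite pickle_pair ex.
Qed.

Lemma pc_cons (X Y : countType) (a : baire -> X -> Y) (s : baire -> X -> seq Y) :
  pc a -> pc s -> pc (fun p x => a p x :: s p x).
Proof.
by apply: (@pc_intro2 X Y (seq Y) (seq Y) cons code_cons) => //; exact: pr_cons.
Qed.

Lemma pc_behead (X Y : countType) (s : baire -> X -> seq Y) :
  pc s -> pc (fun p x => behead (s p x)).
Proof.
apply: (@pc_intro1 X (seq Y) (seq Y) behead code_tail); first exact: pr_tail.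
by case=> [//|y s']; rewrite pickle_cons code_tailK.
Qed.

Lemma pc_ohead (X Y : countType) (s : baire -> X -> seq Y) :
  pc s -> pc (fun p x => ohead (s p x)).
Proof.
apply: (@pc_intro1 X (seq Y) (option Y) ohead
  (fun c => if c == 0 then 0 else code_cons (code_head c) 0)).
  move=> u hu; apply: pr_ifz => //; first exact: PrZero.
  by apply: pr_cons; [exact: pr_head|exact: PrZero].
case=> [//|y s']; rewrite pickle_cons code_headK ifF //.
by case: code_cons (code_cons_gt (pickle y) (pickle s')).
Qed.

Ltac pc_lists := fail.

Ltac pc_extra ::= lazymatch goal with
  | |- pc (fun p x => @?a p x * @?b p x) => refine (pc_mul _ _)
  | |- pc (fun p x => 2 ^ @?a p x) => refine (pc_exp2 _)
  | |- pc (fun p x => Some (@?a p x)) => refine (pc_some _)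
  | |- pc (fun p x => @?a p x :: @?b p x) => refine (pc_cons _ _)
  | |- pc (fun p x => behead (@?a p x)) => refine (pc_behead _)
  | |- pc (fun p x => ohead (@?a p x)) => refine (pc_ohead _)
  | |- pc (fun p x => match _ with Some _ => _ | None => _ end) =>
      refine (pc_match _ _ _)
  | _ => pc_lists
  end.

Lemma pc_onth (X Y : countType) (s : baire -> X -> seq Y) i :
  pc s -> pc i -> pc (fun p x => onth (s p x) (i p x)).
Proof.
move=> hs hi; apply: (@pc_ext X (option Y)
  (fun p x => ohead (iter (i p x) behead (s p x)))).
  by apply: pc_ohead; apply: (pc_iter (h := fun _ _ => behead)); pcs.
move=> p x; move: (i p x) (s p x) => k t.
elim: k t => [|k IH] t; first by case: t.
by rewrite iterSr IH; case: t => //=; rewrite !onth_default.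
Qed.

Lemma size_lt_pickle (Y : countType) (s : seq Y) : size s <= pickle s.
Proof.
elim: s => //= y s IH; rewrite pickle_cons /code_cons.
apply: (@leq_ltn_trans (pickle s)) => //.
apply: (@leq_trans (pickle s).*2.+1); first by rewrite ltnS -addnn leq_addr.
by rewrite leq_pmull // expn_gt0.
Qed.

(** The code bounds the length, so it suffices to count the occupied positions below the code. *)
Lemma pc_size (X Y : countType) (s : baire -> X -> seq Y) :
  pc s -> pc (fun p x => size (s p x)).
Proof.
move=> hs; apply: (@pc_ext X nat (fun p x => \sum_(i < pickle (s p x))
  nat_of_bool (onth (s p x) i != None))).
  apply: (pc_sum (h := fun p x i => nat_of_bool (onth (s p x) i != None))); pcs.
  by apply: pc_onth; pcs.
move=> p x.
have h (t : seq Y) n : \sum_(i < n) nat_of_bool (onth t i != None) = minn n (size t).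
  elim: n => [|n IH]; first by rewrite big_ord0 min0n.
  rewrite big_ord_recr /= IH; have [lt|le] := ltnP n (size t).
    by have := onthTE t n; rewrite lt; case: (onth t n) => //=; lia.
  by rewrite onth_default // eqxx; lia.
by rewrite h; have := size_lt_pickle (s p x); lia.
Qed.

(** A right fold consumes the list from its end, so round [m] treats position [size s - m.+1]. *)
Lemma pc_foldr (X Y Z : countType) (s : baire -> X -> seq Y) (z : baire -> X -> Z) h :
  pc s -> pc z -> pc (fun p (y : X * Y * Z) => h p y.1.1 y.1.2 y.2) ->
  pc (fun p x => foldr (h p x) (z p x) (s p x)).
Proof.
move=> hs hz hh; apply: (@pc_ext X Z (fun p x => nat_rect (fun=> Z) (z p x)
  (fun m acc => if onth (s p x) (size (s p x) - m.+1) is Some y then h p x y acc else acc)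
  (size (s p x)))).
  apply: pc_nat_rect => //; first exact: pc_size.
  apply: pc_match; first (apply: pc_onth; pcs; apply: pc_size; pcs).
    by pcs.
  apply: (pc_comp hh (g := fun _ y => (y.1.1.1, y.2, y.1.2))); pcs.
move=> p x; move: (s p x) => t.
have claim n : n <= size t -> nat_rect (fun=> Z) (z p x) (fun m acc =>
    if onth t (size t - m.+1) is Some y then h p x y acc else acc) n
    = foldr (h p x) (z p x) (drop (size t - n) t).
  elim: n => [|n IH] nt /=; first by rewrite subn0 drop_size.
  have lt : size t - n.+1 < size t by lia.
  rewrite (IH (ltnW nt)); have := onthTE t (size t - n.+1); rewrite lt.
  case e : (onth t _) => [y|] // _; rewrite (drop_nth y lt) /= (@onth_nth _ y y _ _ e).
  by congr (h p x y (foldr _ _ (drop _ _))); lia.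
by rewrite claim // subnn drop0.
Qed.

Lemma pc_mkseq (X Y : countType) n (h : baire -> X -> nat -> Y) :
  pc n -> pc (fun p (y : X * nat) => h p y.1 y.2) ->
  pc (fun p x => mkseq (h p x) (n p x)).
Proof.
move=> hn hh; apply: (@pc_ext X (seq Y) (fun p x => nat_rect (fun=> seq Y) [::]
  (fun m acc => h p x (n p x - m.+1) :: acc) (n p x))); first by pcs.
move=> p x; move: (n p x) => l.
have claim k : k <= l -> nat_rect (fun=> seq Y) [::]
    (fun m acc => h p x (l - m.+1) :: acc) k = [seq h p x i | i <- iota (l - k) k].
  elim: k => [//|k IH] kl /=; rewrite IH 1?ltnW //.
  by have -> : l - k = (l - k.+1).+1 by lia.
by rewrite claim // subnn.
Qed.

Ltac pc_machines := fail.

Ltac pc_lists ::= lazymatch goal with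
  | |- pc (fun p x => onth (@?a p x) (@?b p x)) => refine (pc_onth _ _)
  | |- pc (fun p x => size (@?a p x)) => refine (pc_size _)
  | |- pc (fun p x => foldr _ _ _) => refine (pc_foldr _ _ _)
  | |- pc (fun p x => mkseq _ _) => refine (pc_mkseq _ _)
  | _ => pc_machines
  end.

Lemma pc_of_nat (X : countType) a : pc a -> pc (fun p (x : X) => Cantor.of_nat (a p x)).
Proof.
move=> ha; apply: (@pc_ext X (nat * nat)%type (fun p x => nat_rect (fun=> (nat * nat)%type)
  (0, 0) (fun _ c => if c.1 == 0 then (c.2.+1, 0) else (c.1.-1, c.2.+1)) (a p x))).
  by pcs.
move=> p x; elim: (a p x) => //= n ->; rewrite /Cantor.of_nat /=.
by case: (nat_rec _ _ _ _) => -[|u] v.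
Qed.

Lemma pc_to_nat (X : countType) a b : pc a -> pc b ->
  pc (fun p (x : X) => Cantor.to_nat (a p x, b p x)).
Proof.
move=> ha hb; apply: (@pc_ext X nat (fun p x => b p x + nat_rect (fun=> nat) 0
  (fun i m => i.+1 + m) (b p x + a p x))); first by pcs.
by [].
Qed.

Lemma pc_unary (X : countType) (q : baire -> X -> baire) a :
  pc (fun p (y : X * nat) => q p y.1 y.2) -> pc a ->
  pc (fun p x => unary (q p x) (a p x)).
Proof.
move=> hq ha; apply: (pc_forall (n := fun p x => (a p x).+1)
  (h := fun p x n => a p x != n + \sum_(i < n.+1) q p x i)); first by pcs.
pcs; apply: (pc_sum (n := fun p y => y.2.+1) (h := fun p y i => q p y.1 i)); first by pcs.
by pcs; apply: (pc_comp hq (g := fun p y => (y.1.1, y.2))); pcs.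
Qed.

(** * Decoding machines *)

Section Decoding.
Let decodable (T : countType) := pc (fun (_ : baire) n => unpickle n : option T).

(** The code of a list of numbers is the number it is decoded from, so decoding is tracked by the
    identity. *)
Let pc_decode (X : countType) a : pc a -> pc (fun p (x : X) => CodeSeq.decode (a p x)).
Proof.
apply: (@pc_intro1 X nat (seq nat) CodeSeq.decode id) => // n.
by rewrite -{1}(CodeSeq.decodeK n); congr CodeSeq.code; rewrite map_id.
Qed.

Let decodable_nat : decodable nat.
Proof. by apply: pc_some; exact: pc_id. Qed.

Let decodable_bool : decodable bool.
Proof. by apply: (@pc_ext _ _ (fun _ n => Some (odd n))) => //; pcs. Qed.

Let decodable_dir : decodable dir.
Proof.
apply: (@pc_ext _ (option dir) (fun _ n => if n == 0 then Some GoLeft else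
  if n == 1 then Some Stay else Some GoRight)); first by pcs.
by move=> _ [|[|n]].
Qed.

Let decodable_prod T1 T2 : decodable T1 -> decodable T2 -> decodable (T1 * T2)%type.
Proof.
move=> h1 h2; pose d (_ : baire) n := CodeSeq.decode n.
have hd : pc d by exact: (pc_decode (@pc_id _)).
apply: (@pc_ext _ (option (T1 * T2)) (fun p n => if size (d p n) == 2 then
  if onth (d p n) 0 is Some a then if onth (d p n) 1 is Some b then
  if unpickle a is Some x then if unpickle b is Some y then Some (x : T1, y : T2)
  else None else None else None else None else None)).
  pcs.
  - by apply: (pc_comp h1); pcs.
  - by apply: (pc_comp h2); pcs.
move=> p n; rewrite /d.
(* Pairs inherit their coding from dependent pairs with a constant family; by conversion this is a
   list of length 2. *)
have -> : unpickle n = obind (fun u => Some (pair_of_tag u))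
    (if CodeSeq.decode n is [:: ni; nx] then
     obind (fun i => omap (@Tagged T1 i (fun=> T2)) (unpickle nx)) (unpickle ni)
     else None) by [].
case: CodeSeq.decode => [|a [|b [|c s]]] //=.
by case: (unpickle a) => //= x; case: (unpickle b).
Qed.

Let pc_pmap T (X : countType) a : decodable T -> pc a ->
  pc (fun p (x : X) => pmap unpickle (CodeSeq.decode (a p x)) : seq T).
Proof.
move=> hT ha; apply: (@pc_ext _ (seq T) (fun p x => foldr (fun n acc =>
  if unpickle n is Some y then y :: acc else acc) [::] (CodeSeq.decode (a p x)))).
  by pcs; [exact: pc_decode|apply: (pc_comp hT); pcs].
by move=> p x; elim: (CodeSeq.decode _) => //= n s ->; case: unpickle.
Qed.

Let decodable_seq T : decodable T -> decodable (seq T).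
Proof. by move=> hT; apply: pc_some; apply: pc_pmap => //; exact: pc_id. Qed.

Let decodable_option T : decodable T -> decodable (option T).
Proof.
by move=> hT; apply: pc_some; apply: pc_ohead; apply: pc_pmap => //; exact: pc_id.
Qed.

Let decodable_rule : decodable rule.
Proof.
pose T := (nat * bool * seq (nat * nat * dir) * nat * dir * (option bool * dir))%type.
have hT : decodable T.
  by do !(apply: decodable_prod || apply: decodable_seq || apply: decodable_option) => //.
(* A rule has the code of its tuple, so the conversion is tracked by the identity. *)
have h : pc (fun _ (t : T) => rule_of_tuple t).
  exists (fun _ e => e 0) => [|p t e ->]; first exact: PrVar.
  have E (r : rule) : pickle r = pickle (tuple_of_rule r) by reflexivity.
  by rewrite E; case: t => [[[[[]]]]].
apply: (@pc_ext _ (option rule) (fun p n => if (unpickle n : option T) is Some t then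
  Some (rule_of_tuple t) else None)); last by [].
by apply: pc_match => //; [exact: pc_const|apply/pc_some/(pc_comp h)/pc_snd/pc_id].
Qed.

(** Effectiveness of the numbering of machines; it makes simulation uniform in the index. *)
Lemma pc_nth_machine : pc (fun _ i => nth_machine i).
Proof.
have hT : decodable (nat * seq rule)%type.
  by apply: decodable_prod => //; exact: decodable_seq.
have h : pc (fun _ t => machine_of_pair t).
  exists (fun _ e => e 0) => [|p t e ->]; first exact: PrVar.
  have E (M : machine) : pickle M = pickle (pair_of_machine M) by reflexivity.
  by rewrite E; case: t.
apply: (@pc_ext _ machine (fun p n => if (unpickle n : option (nat * seq rule)) is Some t then
  machine_of_pair t else Machine 0 [::])).
  by apply: pc_match => //; [exact: pc_const|apply/(pc_comp h)/pc_snd/pc_id].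
move=> p n; rewrite /nth_machine.
have -> : (unpickle n : option machine) =
  obind (fun t => Some (machine_of_pair t)) (unpickle n) by [].
by case: (unpickle n).
Qed.

End Decoding.

Section Projections.
Variable X : countType.

Lemma pc_ntapes (a : baire -> X -> machine) : pc a -> pc (fun p x => ntapes (a p x)).
Proof.
have h : pc (fun _ M => pair_of_machine M).
  exists (fun _ e => e 0) => [|p x e ->]; first exact: PrVar.
  reflexivity.
by move=> ha; exact: (pc_fst (pc_comp h ha)).
Qed.

Lemma pc_rules (a : baire -> X -> machine) : pc a -> pc (fun p x => rules (a p x)).
Proof.
have h : pc (fun _ M => pair_of_machine M).
  exists (fun _ e => e 0) => [|p x e ->]; first exact: PrVar.
  reflexivity.
by move=> ha; exact: (pc_snd (pc_comp h ha)).
Qed.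

Variables (r : baire -> X -> rule) (hr : pc r).

Let pc_tuple : pc (fun p x => tuple_of_rule (r p x)).
Proof.
have h : pc (fun _ r => tuple_of_rule r).
  exists (fun _ e => e 0) => [|p x e ->]; first exact: PrVar.
  reflexivity.
exact: (pc_comp h hr).
Qed.

Lemma pc_rule_src : pc (fun p x => rule_src (r p x)).
Proof. exact: (pc_fst (pc_fst (pc_fst (pc_fst (pc_fst pc_tuple))))). Qed.

Lemma pc_rule_bit : pc (fun p x => rule_bit (r p x)).
Proof. exact: (pc_snd (pc_fst (pc_fst (pc_fst (pc_fst pc_tuple))))). Qed.

Lemma pc_rule_work : pc (fun p x => rule_work (r p x)).
Proof. exact: (pc_snd (pc_fst (pc_fst (pc_fst pc_tuple)))). Qed.

Lemma pc_rule_dst : pc (fun p x => rule_dst (r p x)).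
Proof. exact: (pc_snd (pc_fst (pc_fst pc_tuple))). Qed.

Lemma pc_rule_in : pc (fun p x => rule_in (r p x)).
Proof. exact: (pc_snd (pc_fst pc_tuple)). Qed.

Lemma pc_rule_out : pc (fun p x => rule_out (r p x)).
Proof. exact: (pc_snd pc_tuple). Qed.

End Projections.

Lemma pc_map (X Y Z : countType) (s : baire -> X -> seq Y) (h : baire -> X -> Y -> Z) :
  pc s -> pc (fun p (y : X * Y) => h p y.1 y.2) -> pc (fun p x => map (h p x) (s p x)).
Proof.
move=> hs hh; apply: (@pc_ext X (seq Z)
  (fun p x => foldr (fun y acc => h p x y :: acc) [::] (s p x))); last first.
  by move=> p x; elim: (s p x) => //= y t ->.
pcs; by apply: (pc_comp hh (g := fun _ y => (y.1.1, y.1.2))); pcs.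
Qed.

(** * Step-bounded simulation of machines

A simulated configuration is a state, an input position, the work tapes and the
number of zeros written so far; the contents of the output tape are not kept. *)

Definition tape_code := (seq nat * nat * seq nat)%type.
Definition sim_config := (nat * nat * seq tape_code * nat)%type.

Definition code_tape (t : tape) : tape_code := (tleft t, tsym t, tright t).

Definition head0 (s : seq nat) := if ohead s is Some n then n else 0.

Definition sim_move (d : dir) (t : tape_code) : tape_code :=
  if d == GoLeft then (behead t.1.1, head0 t.1.1, t.1.2 :: t.2)
  else if d == Stay then t else (t.1.2 :: t.1.1, head0 t.2, behead t.2).

Definition sim_head (d : dir) n :=
  if d == GoLeft then n.-1 else if d == Stay then n else n.+1.

Definition sim_applicable (b : bool) (c : sim_config) (r : rule) :=
  [&& rule_src r == c.1.1.1, rule_bit r == b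
    & [seq w.1.1 | w <- rule_work r] == [seq t.1.2 | t <- c.1.2]].

(** The nested subtraction is the minimum of the two lengths, which is the length of the [zip] in
    [apply_rule]; hence the default tapes never arise. *)
Definition sim_apply (r : rule) (c : sim_config) : sim_config :=
  (rule_dst r, sim_head (rule_in r) c.1.1.2,
   mkseq (fun j => if onth (rule_work r) j is Some w then
       if onth c.1.2 j is Some t then sim_move w.2 (t.1.1, w.1.2, t.2)
       else ([::], 0, [::])
     else ([::], 0, [::])) (size (rule_work r) - (size (rule_work r) - size c.1.2)),
   c.2 + ((rule_out r).1 == Some false)).

(** Folding from the right lets the first applicable rule override the later ones, as in [step]. *)
Definition sim_step M b c :=
  foldr (fun r acc => if sim_applicable b c r then sim_apply r c else acc) c (rules M).

Definition sim_init k : sim_config := (0, 0, mkseq (fun=> ([::], 0, [::])) k, 0).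

Definition sim_run M (x : nat -> bool) t : sim_config :=
  iter t (fun c => sim_step M (x c.1.1.2) c) (sim_init (ntapes M)).

Definition sim_halted M x t : bool :=
  let c := sim_run M x t in
  foldr (fun r acc => ~~ sim_applicable (x c.1.1.2) c r && acc) true (rules M).

Definition abs (c : config) z : sim_config :=
  (cstate c, cin c, [seq code_tape t | t <- cwork c], z).

Lemma sim_headE d n : sim_head d n = move_head d n.
Proof. by case: d. Qed.

Lemma sim_moveE d t : sim_move d (code_tape t) = code_tape (move_tape d t).
Proof. by case: d; case: t => [[|a l] b [|c r]]. Qed.

Lemma sim_applicableE x c z r :
  sim_applicable (x (cin c)) (abs c z) r = applicable x c r.
Proof. by rewrite /sim_applicable /applicable /= -map_comp. Qed.

Lemma sim_applyE r c z : sim_apply r (abs c z) =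
  abs (apply_rule r c) (z + ((rule_out r).1 == Some false)).
Proof.
rewrite /sim_apply /abs /= sim_headE; congr (_, _, _, _).
rewrite size_map -map_comp; set ws := rule_work r; set ts := cwork c.
have -> : size ws - (size ws - size ts) = size (zip ws ts).
  by rewrite size_zip; lia.
have -> : map (code_tape \o (fun wt => move_tape wt.1.2 (write_tape wt.1.1.2 wt.2)))
    (zip ws ts) = map (fun wt : nat * nat * dir * tape =>
     sim_move wt.1.2 ((code_tape wt.2).1.1, wt.1.1.2, (code_tape wt.2).2)) (zip ws ts).
  by apply: eq_map => -[w t]; exact: (esym (sim_moveE w.2 (write_tape w.1.2 t))).
elim: ws ts => [|w ws IH] [|t ts] //=.
by rewrite /mkseq /= -IH /mkseq (iotaDl 1 0) -map_comp.
Qed.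

Definition zeros_of M (x : nat -> bool) (c : config) : nat :=
  if [seq r <- rules M | applicable x c r] is r :: _
  then (rule_out r).1 == Some false else 0.

Lemma sim_stepE M x c z :
  sim_step M (x (cin c)) (abs c z) = abs (step M x c) (z + zeros_of M x c).
Proof.
rewrite /sim_step /step /zeros_of; elim: (rules M) => [|r s IH] /=.
  by rewrite addn0.
by rewrite sim_applicableE IH; case: ifP; rewrite ?sim_applyE.
Qed.

(** Each entry of an output ends with a 0, so for a one-way machine this is the number of entries
    completed by time [t]. *)
Definition zeros M x t := (sim_run M x t).2.

Lemma sim_runE M x t : sim_run M x t = abs (iter t (step M x) (init M)) (zeros M x t).
Proof.
suff [z e] : exists z, sim_run M x t = abs (iter t (step M x) (init M)) z.
  by rewrite /zeros e.
elim: t => [|t [z IH]].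
  exists 0; rewrite /sim_run /= /abs /=; congr (_, _, _, _).
  elim: (ntapes M) => //= k IH; rewrite -IH /mkseq /= (iotaDl 1 0) -map_comp.
  by congr cons.
exists (z + zeros_of M x (iter t (step M x) (init M))).
by rewrite /sim_run /= -/(sim_run M x t) IH -sim_stepE.
Qed.

Lemma zerosS M x t : zeros M x t.+1 =
  zeros M x t + zeros_of M x (iter t (step M x) (init M)).
Proof.
rewrite {1}/zeros /sim_run iterS -/(sim_run M x t) sim_runE.
by rewrite (sim_stepE M x).
Qed.

Lemma sim_haltedE M x t :
  sim_halted M x t = ~~ has (applicable x (iter t (step M x) (init M))) (rules M).
Proof.
rewrite /sim_halted sim_runE /= -all_predC.
elim: (rules M) => //= r s ->.
by rewrite (sim_applicableE x).
Qed.

Lemma sim_halted_halts M p : halts M p <-> exists t, sim_halted M (unary p) t.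
Proof. by split=> -[t h]; exists t; move: h; rewrite sim_haltedE. Qed.

Lemma sim_halted_mono M x s t : s <= t -> sim_halted M x s -> sim_halted M x t.
Proof.
move=> /subnK <-; rewrite !sim_haltedE => h; elim: (t - s) => [//|k IH].
rewrite addSn iterS; set c := iter (k + s) _ _ in IH *.
have -> : step M x c = c; last by [].
rewrite /step; case e: [seq r <- rules M | applicable x c r] => [//|r l].
have : r \in [seq r <- rules M | applicable x c r] by rewrite e mem_head.
by rewrite mem_filter => /andP[ar rM]; case/hasP: IH; exists r.
Qed.

Lemma pc_head0 (X : countType) (s : baire -> X -> seq nat) :
  pc s -> pc (fun p x => head0 (s p x)).
Proof.
move=> hs; apply: (pc_match (o := fun p x => ohead (s p x)) (d := fun _ _ => 0)
  (h := fun _ _ n => n)); pcs.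
Qed.

Ltac pc_machines ::= lazymatch goal with
  | |- pc (fun p x => map _ _) => refine (pc_map _ _)
  | |- pc (fun p x => head0 _) => refine (pc_head0 _)
  | |- pc (fun p x => rules _) => refine (pc_rules _)
  | |- pc (fun p x => ntapes _) => refine (pc_ntapes _)
  | |- pc (fun p x => rule_src _) => refine (pc_rule_src _)
  | |- pc (fun p x => rule_bit _) => refine (pc_rule_bit _)
  | |- pc (fun p x => rule_work _) => refine (pc_rule_work _)
  | |- pc (fun p x => rule_dst _) => refine (pc_rule_dst _)
  | |- pc (fun p x => rule_in _) => refine (pc_rule_in _)
  | |- pc (fun p x => rule_out _) => refine (pc_rule_out _)
  | |- pc (fun p x => unary _ _) => refine (pc_unary _ _)
  | |- pc (fun p x => Cantor.of_nat _) => refine (pc_of_nat _)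
  | |- pc (fun p x => Cantor.to_nat (_, _)) => refine (pc_to_nat _ _)
  end.

Lemma pc_sim_move (X : countType) d t :
  pc d -> pc t -> pc (fun p (x : X) => sim_move (d p x) (t p x)).
Proof. by move=> hd ht; rewrite /sim_move; pcs. Qed.

Lemma pc_sim_head (X : countType) d n :
  pc d -> pc n -> pc (fun p (x : X) => sim_head (d p x) (n p x)).
Proof. by move=> hd ht; rewrite /sim_head; pcs. Qed.

Lemma pc_sim_applicable (X : countType) b c r : pc b -> pc c -> pc r ->
  pc (fun p (x : X) => sim_applicable (b p x) (c p x) (r p x)).
Proof. by move=> hb hc hr; rewrite /sim_applicable; pcs. Qed.

Lemma pc_sim_apply (X : countType) r c : pc r -> pc c ->
  pc (fun p (x : X) => sim_apply (r p x) (c p x)).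
Proof.
move=> hr hc; rewrite /sim_apply; pcs; first by apply: pc_sim_head; pcs.
by apply: pc_sim_move; pcs.
Qed.

Lemma pc_sim_step (X : countType) M b c : pc M -> pc b -> pc c ->
  pc (fun p (x : X) => sim_step (M p x) (b p x) (c p x)).
Proof.
move=> hM hb hc; rewrite /sim_step; pcs; first by apply: pc_sim_applicable; pcs.
by apply: pc_sim_apply; pcs.
Qed.

Lemma pc_sim_run (X : countType) (M : baire -> X -> machine) x t :
  pc M -> pc (fun p (y : X * nat) => x p y.1 y.2) -> pc t ->
  pc (fun p y => sim_run (M p y) (x p y) (t p y)).
Proof.
move=> hM hx ht; rewrite /sim_run /sim_init; pcs.
by apply: pc_sim_step; pcs.
Qed.

Lemma pc_zeros (X : countType) (M : baire -> X -> machine) x t :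
  pc M -> pc (fun p (y : X * nat) => x p y.1 y.2) -> pc t ->
  pc (fun p y => zeros (M p y) (x p y) (t p y)).
Proof. by move=> hM hx ht; apply/pc_snd/pc_sim_run. Qed.

Lemma pc_sim_halted (X : countType) (M : baire -> X -> machine) x t :
  pc M -> pc (fun p (y : X * nat) => x p y.1 y.2) -> pc t ->
  pc (fun p y => sim_halted (M p y) (x p y) (t p y)).
Proof.
move=> hM hx ht; rewrite /sim_halted.
have hr := pc_sim_run hM hx ht; pcs; apply: pc_sim_applicable; pcs.
all: by apply: (pc_comp hr); pcs.
Qed.

Lemma pr_of_pc f : pc f -> pr (fun p e => f p (e 0)).
Proof. by case=> g g1 g2; apply: (pr_ext g1) => p e; rewrite (g2 p (e 0)). Qed.

(** Round [n] writes cell [n] and never takes the rewinding action 2, so the one-way driver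
    suffices. *)
Lemma computes_pc (r : baire -> baire) : pc r ->
  exists2 M, one_way M & forall p, produces M p (r p).
Proof.
move=> hr; pose A p n := nat_of_bool (unary (r p) n).
have hA : pc A.
  by apply: pc_nat; apply: pc_unary => //; [apply: (pc_comp hr); pcs|exact: pc_id].
have [|M /(_ isT) M1 MP] := pr_machine false (pr_of_pc hA).
  by move=> p n; rewrite /A; case: unary.
exists M => // p j.
have acts n : actions false A p n = (fun i => if i < n then Some (unary (r p) i) else None, n).
  elim: n => [|n IH] //=; rewrite IH /A; case u : unary => /=; congr pair.
  - apply: funext => i; rewrite /out_upd andbT.
    have -> : (i < n.+1) = (i == n) || (i < n) by lia.
    by case: eqP => [->|//]; rewrite u.
  - apply: funext => i; rewrite /out_upd andbT.
    have -> : (i < n.+1) = (i == n) || (i < n) by lia.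
    by case: eqP => [->|//]; rewrite u.
have [|t0 h] := MP p (fun out => out j = Some (unary (r p) j)) j.+1.
  by move=> n nj; rewrite acts /= nj.
by exists t0.
Qed.

(** * Guessing with finitely many mind changes *)

Section Guess.
Variables (g : baire -> nat -> nat) (Q : baire -> nat -> baire).
Hypotheses (hg : pc g) (hQ : pc (fun p y => Q p y.1 y.2)).

Definition stable_from p s0 := forall s, s0 <= s -> g p s = g p s0.

(* Stage [s] of the output machine consists of the steps [n = <x, y>] with
   [x + y = s]: an even stage rewinds the output head, an odd stage rewrites
   the first [s + 1] cells according to the current guess. *)
Let A p n : nat := let s := (Cantor.of_nat n).1 + (Cantor.of_nat n).2 in
  if odd s then nat_of_bool (unary (Q p (g p s)) (Cantor.of_nat n).2) else 2.

Let hA : pc A.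
Proof. by rewrite /A; pcs. Qed.

Let A2 p n : A p n <= 2.
Proof. by rewrite /A; case: ifP => // _; case: unary. Qed.

Lemma of_natS n : Cantor.of_nat n.+1 =
  let: (x, y) := Cantor.of_nat n in if x is x'.+1 then (x', y.+1) else (y.+1, 0).
Proof. by []. Qed.

Let stage n := (Cantor.of_nat n).1 + (Cantor.of_nat n).2.
Let cell n := (Cantor.of_nat n).2.
Let out p n := (actions true A p n).1.

(** An even stage [s] begins with the head in cell [s], just behind what the odd stage before it
    wrote. The last of its [s + 1] moves has no effect, so the next stage starts writing in cell
    0. *)
Let posE p n : (actions true A p n).2 =
  if odd (stage n) then cell n else (Cantor.of_nat n).1.
Proof.
elim: n => //= n IH; rewrite {1}/A -/(stage n).
have -> : (action true (if odd (stage n) then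
    nat_of_bool (unary (Q p (g p (stage n))) (Cantor.of_nat n).2) else 2)
    (actions true A p n)).2 = if odd (stage n) then (actions true A p n).2.+1
    else (actions true A p n).2.-1.
  by case: ifP => // _; case: unary.
move: IH; rewrite /stage /cell of_natS; case: (Cantor.of_nat n) => -[|x] y /= ->.
  by rewrite add0n addn0 /=; case: odd.
by rewrite addnS /=; case: odd.
Qed.

Let outS p n : out p n.+1 = if odd (stage n) then
  out_upd (Some (unary (Q p (g p (stage n))) (cell n))) (cell n) (out p n) else out p n.
Proof.
rewrite /out /= {1}/A -/(stage n).
have act b u : (action true (nat_of_bool b) u).1 = out_upd (Some b) u.2 u.1 by case: b.
by case: ifP => // o; rewrite act posE o.
Qed.

Let out_lt p n j : out p n j <> None -> j < n.
Proof.
elim: n => [//|n IH]; rewrite outS; case: ifP => [_|_ /IH]; last exact: leqW.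
rewrite /out_upd andbT; case: eqP => [-> _|_ /IH]; last exact: leqW.
have := Cantor.to_nat_non_decreasing (Cantor.of_nat n).1 (cell n).
by rewrite /cell -surjective_pairing Cantor.cancel_to_of; lia.
Qed.

Section Limit.
Variables (p : baire) (s0 : nat).
Hypothesis stab : stable_from p s0.
Let q := Q p (g p s0).
Let N0 := Cantor.to_nat (s0, 0).

Let stage_ge n : N0 <= n -> s0 <= stage n.
Proof.
move=> /subnK <-; elim: (n - N0) => [|k IH].
  by rewrite /stage add0n Cantor.cancel_of_to leq_addr.
apply: leq_trans IH _; rewrite addSn /stage of_natS.
by case: (Cantor.of_nat _) => -[|x] y /=; lia.
Qed.

Let out_step n j : N0 <= n ->
  out p n.+1 j = if odd (stage n) && (j == cell n) then Some (unary q j) else out p n j.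
Proof.
move=> /stage_ge /stab gs; rewrite outS gs; case: odd => //=.
by rewrite /out_upd andbT; case: eqP => // ->.
Qed.

Let out_persist n m j : N0 <= n -> n <= m -> out p n j = Some (unary q j) ->
  out p m j = Some (unary q j).
Proof.
move=> Nn /subnK <- e; elim: (m - n) => // k IH.
by rewrite addSn out_step ?IH ?if_same // (leq_trans Nn) // leq_addl.
Qed.

Let out_attained j : exists2 n, N0 <= n & out p n j = Some (unary q j).
Proof.
(* This puts the visit of cell [j] into the odd stage 2 (N0 + j) + 1, which lies after step [N0]. *)
pose x := (N0 + j).*2.+1 - j; pose n := Cantor.to_nat (x, j).
have Nn : N0 <= n.
  have := Cantor.to_nat_non_decreasing x j; rewrite -/n /x; lia.
exists n.+1; first exact: leqW.
rewrite out_step // /stage /cell /n Cantor.cancel_of_to /= eqxx.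
have -> : x + j = (N0 + j).*2.+1 by rewrite /x; lia.
by rewrite /= odd_double.
Qed.

Let out_or n j : N0 <= n -> out p n j <> None ->
  j < N0 \/ out p n j = Some (unary q j).
Proof.
move=> /subnK <-; elim: (n - N0) => [|k IH]; first by move/out_lt; left.
rewrite addSn out_step ?leq_addl //; case: ifP => [_ _|_]; [by right|exact: IH].
Qed.

(** Only cells below [N0] can hold bits of earlier guesses; being finitely many, they are all
    rewritten by some step [N1]. Every other cell is first written after step [N0], hence
    correctly. *)
Let out_correct : exists2 N1, N0 <= N1 & forall n, N1 <= n ->
  forall j, out p n j <> None -> out p n j = Some (unary q j).
Proof.
have /(_ N0)[N1 N01 N1P] : forall k, exists2 N1, N0 <= N1 & forall j, j < k ->
    out p N1 j = Some (unary q j).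
  elim=> [|k [N1 N01 IH]]; first by exists N0.
  have [n Nn nk] := out_attained k; exists (maxn N1 n) => [|j].
    by rewrite (leq_trans N01) // leq_maxl.
  rewrite ltnS leq_eqVlt => /predU1P[->|jk].
    by apply: out_persist nk => //; exact: leq_maxr.
  by apply: out_persist (IH j jk) => //; exact: leq_maxl.
exists N1 => // n Nn j /out_or[|jN|//]; first exact: leq_trans Nn.
exact: out_persist (N1P j jN).
Qed.

Lemma limit_outputs : (forall j, exists n0, forall n, n0 <= n ->
    (actions true A p n).1 j = Some (unary q j)) /\
  exists n0, forall n, n0 <= n -> forall j, (actions true A p n).1 j <> None ->
    (actions true A p n).1 j = Some (unary q j).
Proof.
split=> [j|]; last by have [N1 _ h] := out_correct; exists N1.
by have [n Nn nj] := out_attained j; exists n => m nm; apply: out_persist nj.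
Qed.

End Limit.

Lemma cout_step M x c j : cout c j <> None -> cout (step M x c) j <> None.
Proof.
by rewrite /step; case: [seq _ <- _ | _] => //= r s; case: ifP => // /andP[_]; case: (_.1).
Qed.

Lemma computes_guess : exists M, forall p s0, stable_from p s0 ->
  produces M p (Q p (g p s0)) /\ finite_set [set t | revises M p t].
Proof.
have [M _ MP] := pr_machine true (pr_of_pc hA) A2; exists M => p s0 st.
have [h1 [n0 h2]] := limit_outputs st; split=> [j|].
  have [n nP] := h1 j.
  have [t0 h] := MP p (fun o => o j = Some (unary (Q p (g p s0)) j)) n nP.
  by exists t0.
have [t0 h] := MP p (fun o => forall j, o j <> None ->
  o j = Some (unary (Q p (g p s0)) j)) n0 h2.
(* A nonblank cell is never blanked, and from [t0] on it holds its final bit, so every revision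
   happens before [t0]. *)
apply: (@sub_finite_set _ _ `I_t0); last exact: finite_II.
move=> t [j [tj ne]]; rewrite /= ltnNge; apply/negP => le; apply: ne.
rewrite (h t le j tj); apply: h; first exact: leqW.
exact: cout_step.
Qed.

End Guess.

(** * The Turing jump *)

(** It walks to cell [j] and loops there on reading 1. Its halting reveals one bit of the input,
    whence the injectivity of the jump. *)
Definition bit_tester j := Machine 0
  (flatten [seq [:: Rule s true [::] s.+1 GoRight (None, Stay);
                    Rule s false [::] s.+1 GoRight (None, Stay)] | s <- iota 0 j]
   ++ [:: Rule j true [::] j Stay (None, Stay)]).

Lemma bit_tester_halts j p : halts (bit_tester j) p <-> unary p j = false.
Proof.
set M := bit_tester j.
have inM r : r \in rules M -> (exists s b, s < j /\
    r = Rule s b [::] s.+1 GoRight (None, Stay)) \/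
    r = Rule j true [::] j Stay (None, Stay).
  rewrite mem_cat => /orP[/flattenP[s /mapP[i]]|].
    rewrite mem_iota => /= ij ->; rewrite !inE => /orP[]/eqP->; left; exists i.
      by exists true.
    by exists false.
  by rewrite inE => /eqP ->; right.
have walkM s b : s < j -> Rule s b [::] s.+1 GoRight (None, Stay) \in rules M.
  move=> sj; rewrite mem_cat; apply/orP; left; apply/flattenP.
  exists [:: Rule s true [::] s.+1 GoRight (None, Stay);
             Rule s false [::] s.+1 GoRight (None, Stay)].
    by apply/mapP; exists s; rewrite // mem_iota.
  by rewrite !inE; case: b; rewrite eqxx ?orbT.
have loopM : Rule j true [::] j Stay (None, Stay) \in rules M.
  by rewrite mem_cat mem_head orbT.
have walk t : t <= j -> [/\ cstate (run M p t) = t, cin (run M p t) = t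
    & cwork (run M p t) = [::]].
  elim: t => [//|t IH] tj; have [e1 e2 e3] := IH (ltnW tj).
  rewrite /run iterS -/(run M p t).
  rewrite (@step_unique _ _ _ (Rule t (unary p t) [::] t.+1 GoRight (None, Stay))).
  - by case: (run M p t) e2 e3 => a b c d e /= -> ->.
  - exact: walkM.
  - by rewrite /applicable e1 e2 e3 /= !eqxx.
  move=> r /inM[[s [b [_ ->]]]|->]; rewrite /applicable e1 e2 /=.
    by case/and3P=> /eqP -> /eqP ->.
  by case/andP=> /eqP ej; rewrite ej ltnn in tj.
have [e1 e2 e3] := walk j (leqnn j).
split=> [[t]|xj]; last first.
  exists j; apply/hasPn => r /inM[[s [b [sj ->]]]|->]; rewrite /applicable e1 e2 /=.
    by rewrite (ltn_eqF sj).
  by rewrite xj andbF.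
case xj : (unary p j) => // /hasP; case.
have [tj|jt] := leqP t j.
  have [f1 f2 f3] := walk t tj; move: tj; rewrite leq_eqVlt => /predU1P[tj|tj].
    exists (Rule j true [::] j Stay (None, Stay)) => //.
    by rewrite /applicable f1 f2 f3 tj /= xj !eqxx.
  exists (Rule t (unary p t) [::] t.+1 GoRight (None, Stay)); first exact: walkM.
  by rewrite /applicable f1 f2 f3 /= !eqxx.
exists (Rule j true [::] j Stay (None, Stay)) => //.
have /(_ (t - j)) : forall k, [/\ cstate (run M p (k + j)) = j, cin (run M p (k + j)) = j
    & cwork (run M p (k + j)) = [::]].
  elim=> [//|k [f1 f2 f3]]; rewrite addSn /run iterS -/(run M p _).
  rewrite (@step_unique _ _ _ (Rule j true [::] j Stay (None, Stay))) //.
  - by case: (run M p (k + j)) f2 f3 => a b c d e /= -> ->.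
  - by rewrite /applicable f1 f2 f3 /= xj !eqxx.
  move=> r /inM[[s [b [sj ->]]]|-> //]; rewrite /applicable f1 /=.
  by rewrite (ltn_eqF sj).
rewrite subnK ?(ltnW jt) // => -[f1 f2 f3].
by rewrite /applicable f1 f2 f3 /= xj !eqxx.
Qed.

Lemma jump_inj : injective jump.
Proof.
move=> p q e; apply: unary_inj => j.
have h M : halts M p <-> halts M q.
  have := congr1 (fun f : baire => f (pickle M)) e.
  rewrite /jump /nth_machine pickleK /=.
  by do 2!case: asboolP => ? //; split.
have := bit_tester_halts j p; have := bit_tester_halts j q.
have := h (bit_tester j).
case: (unary p j); case: (unary q j) => // h1 h2 h3.
  by have := h3.1 (h1.2 (h2.2 erefl)).
by have := h2.1 (h1.1 (h3.2 erefl)).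
Qed.

Lemma is_limit_unique r s s' : is_limit r s -> is_limit r s' -> s = s'.
Proof.
move=> h h'; apply: funext => k; have [N _ hN] := h k; have [N' _ hN'] := h' k.
by rewrite -(hN (maxn N N') (leq_maxl _ _)) -(hN' (maxn N N') (leq_maxr _ _)).
Qed.

(** * Stabilising guesses give low and finitely revising realizers *)

Section GuessRealizers.
Variables (g : baire -> nat -> nat) (Q : baire -> nat -> baire).
Hypotheses (hg : pc g) (hQ : pc (fun p y => Q p y.1 y.2)).

Lemma guess_unique p q q' :
  (exists2 s0, stable_from g p s0 & q = Q p (g p s0)) ->
  (exists2 s0, stable_from g p s0 & q' = Q p (g p s0)) -> q = q'.
Proof.
move=> [s0 h ->] [s0' h' ->].
by rewrite -(h (maxn s0 s0') (leq_maxl _ _)) -(h' (maxn s0 s0') (leq_maxr _ _)).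
Qed.

Definition guess_function := PFunction guess_unique.

Lemma guess_fin_mind_changes : computable_fin_mind_changes guess_function.
Proof.
have [M MP] := computes_guess hg hQ; exists M => p q [s0 st ->]; exact: MP.
Qed.

Let jump_approx p m : nat :=
  let: (i, k) := Cantor.of_nat m in sim_halted (nth_machine k) (unary (Q p (g p i))) i.

Let jump_approx_pc : pc jump_approx.
Proof.
apply: (@pc_ext _ nat (fun p m => nat_of_bool (sim_halted
  (nth_machine (Cantor.of_nat m).2) (unary (Q p (g p (Cantor.of_nat m).1)))
  (Cantor.of_nat m).1))); last first.
  by move=> p m; rewrite /jump_approx; case: (Cantor.of_nat m).
have hM := pc_nth_machine.
by pcs; apply: pc_sim_halted; pcs; apply: (pc_comp hM); pcs.
Qed.

(** From [s0] on the simulated input no longer changes; halting within [i] steps is then monotone in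
    [i], so each position converges. *)
Lemma jump_approx_limit p s0 : stable_from g p s0 ->
  is_limit (jump_approx p) (jump (Q p (g p s0))).
Proof.
move=> st k; rewrite /jump; case: asboolP => [/sim_halted_halts[t ht]|h].
  exists (maxn s0 t) => // i /= ; rewrite geq_max => /andP[si ti].
  rewrite /jump_approx /cantor_pair Cantor.cancel_of_to st //.
  by rewrite (sim_halted_mono ti ht).
exists s0 => // i /= si; rewrite /jump_approx /cantor_pair Cantor.cancel_of_to st //.
by case hh : sim_halted => //; case: h; apply/sim_halted_halts; exists i.
Qed.

Let approx_unique p r r' :
  (exists s0, stable_from g p s0) /\ r = jump_approx p ->
  (exists s0, stable_from g p s0) /\ r' = jump_approx p -> r = r'.
Proof. by move=> [_ ->] [_ ->]. Qed.

(** Taken to be [jump] inverse after limit after [jump_approx], so that the equivalence demanded by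
    [low] holds almost by definition; injectivity of the jump makes it single-valued. *)
Let low_graph p q := (exists s0, stable_from g p s0) /\
  is_limit (jump_approx p) (jump q).

Let low_unique p q q' : low_graph p q -> low_graph p q' -> q = q'.
Proof. by move=> [_ h] [_ h']; apply: jump_inj; exact: is_limit_unique h h'. Qed.

Lemma guess_low : exists2 F, low F &
  forall p q, guess_function p q -> F p q.
Proof.
exists (PFunction low_unique); last first.
  by move=> p q [s0 st ->]; split; [exists s0|exact: jump_approx_limit].
exists (PFunction approx_unique).
  have [M M1 MP] := computes_pc jump_approx_pc.
  by exists M => // p q [_ ->]; exact: MP.
move=> p q; split=> [[st h]|[r [s [[st er] h e]]]].
  by exists (jump_approx p), (jump q).
by split=> //; rewrite e -er.
Qed.

Lemma guess_realizers (R : realType) (f : R -> R) :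
  realizes guess_function f ->
  [/\ has_realizer computable_fin_mind_changes f, has_realizer low f
    & has_realizer limit_computable f].
Proof.
move=> h; split.
- by exists guess_function => //; exact: guess_fin_mind_changes.
- have [F lF FP] := guess_low; exists F => // p x px.
  by have [q gq fq] := h p x px; exists q => //; exact: FP.
- exists guess_function => //; have [M MP] := guess_fin_mind_changes.
  by exists M => p q /MP[].
Qed.

End GuessRealizers.

(** * The use principle *)

Lemma applicable_local x x' c : x (cin c) = x' (cin c) ->
  applicable x c =1 applicable x' c.
Proof. by move=> e r; rewrite /applicable e. Qed.

Lemma cin_step M x c : cin (step M x c) <= (cin c).+1.
Proof.
by rewrite /step; case: [seq _ <- _ | _] => //= r _; case: (rule_in r) => /=; lia.
Qed.

Section Local.
Variables (M : machine) (x x' : nat -> bool).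
Let c t := iter t (step M x) (init M).
Let c' t := iter t (step M x') (init M).

Let cin_le t : cin (c t) <= t.
Proof.
elim: t => // t IH; rewrite /c iterS.
by apply: leq_trans (cin_step _ _ _) _; rewrite ltnS.
Qed.

Lemma iter_step_local t : (forall j, j < t -> x j = x' j) -> c t = c' t.
Proof.
elim: t => // t IH h; rewrite /c' iterS -/(c' t) -IH; last first.
  by move=> j jt; apply/h/leqW.
have e : x (cin (c t)) = x' (cin (c t)) by apply: h; rewrite ltnS cin_le.
by rewrite /c iterS -/(c t) /step (eq_filter (applicable_local e)).
Qed.

Lemma zeros_local t : (forall j, j < t -> x j = x' j) -> zeros M x t = zeros M x' t.
Proof.
elim: t => // t IH h; rewrite !zerosS IH; last by move=> j jt; apply/h/leqW.
rewrite -/(c t) -/(c' t) -iter_step_local; last by move=> j jt; apply/h/leqW.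
have e : x (cin (c t)) = x' (cin (c t)) by apply: h; rewrite ltnS cin_le.
by rewrite /zeros_of (eq_filter (applicable_local e)).
Qed.

End Local.

Definition zero_count (q : baire) l := count (fun j => ~~ unary q j) (iota 0 l).

Lemma zero_countS q l : zero_count q l.+1 = zero_count q l + ~~ unary q l.
Proof. by rewrite /zero_count -addn1 iotaD count_cat /= addn0 add0n. Qed.

Lemma leq_zero_count q l l' : l <= l' -> zero_count q l <= zero_count q l'.
Proof. by move=> /subnKC <-; rewrite /zero_count iotaD count_cat leq_addr. Qed.

Lemma zero_count_pos q k : zero_count q (zero_pos q k) = k.
Proof.
have h n : zero_count q (block_start q n) = n ->
    zero_count q (zero_pos q n) = n.
  move=> e; rewrite zero_posE; have : q n <= q n by [].
  elim: {-2}(q n) => [|m IH] mq; first by rewrite addn0.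
  rewrite addnS zero_countS (IH (ltnW mq)).
  by rewrite (unary_one mq) addn0.
apply: (h k); elim: k => [|k IH]; first by rewrite /block_start big_ord0.
by rewrite block_startS zero_countS h // unary_zero addn1.
Qed.

Section OneWay.
Variables (M : machine) (x : nat -> bool).
Hypothesis M1 : one_way M.
Let c t := iter t (step M x) (init M).

Let step_cases t :
  [/\ cout (c t.+1) = cout (c t), coutpos (c t.+1) = coutpos (c t)
    & zeros_of M x (c t) = 0] \/
  exists b, [/\ cout (c t.+1) = out_upd (Some b) (coutpos (c t)) (cout (c t)),
    coutpos (c t.+1) = (coutpos (c t)).+1 & zeros_of M x (c t) = ~~ b].
Proof.
rewrite /c iterS -/(c t) /step /zeros_of.
case e: [seq r <- rules M | applicable x (c t) r] => [|r s]; first by left.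
have : r \in [seq r <- rules M | applicable x (c t) r] by rewrite e mem_head.
rewrite mem_filter => /andP[_ rM]; have /allP/(_ r rM) := M1; rewrite /=.
case: (rule_out r) => -[b|] [] //= _; last first.
  by left; split=> //; apply: funext => n; rewrite andbF.
by right; exists b; split=> //; case: b.
Qed.

Lemma one_way_written t j : cout (c t) j <> None <-> j < coutpos (c t).
Proof.
elim: t => [//|t IH]; have [[-> -> _]|[b [-> -> _]]] := step_cases t; first exact: IH.
rewrite /out_upd andbT ltnS leq_eqVlt; case: eqP => //= _; exact: IH.
Qed.

Lemma one_way_keeps s t j : s <= t -> cout (c s) j <> None -> cout (c t) j = cout (c s) j.
Proof.
move=> /subnK <- h; elim: (t - s) => // k IH; rewrite addSn.
have [[-> _ _] //|[b [-> _ _]]] := step_cases (k + s).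
rewrite /out_upd; case: eqP => //= e; move: h; rewrite -IH.
by move/one_way_written; rewrite e ltnn.
Qed.

Lemma one_way_zeros t : zeros M x t =
  count (fun j => cout (c t) j == Some false) (iota 0 (coutpos (c t))).
Proof.
elim: t => [//|t IH]; rewrite zerosS -/(c t) IH.
have [[-> -> ->]|[b [-> -> ->]]] := step_cases t; first by rewrite addn0.
rewrite -[(coutpos (c t)).+1]addn1 iotaD count_cat /= addn0 add0n.
rewrite {2}/out_upd eqxx /=; congr (_ + _); last by case: b.
by apply: eq_in_count => j; rewrite mem_iota /out_upd => /ltn_eqF ->.
Qed.

End OneWay.

Section Use.
Variables (M : machine) (p q : baire).
Hypotheses (M1 : one_way M) (Mpq : produces M p q).

(** A one-way machine never changes a written cell, so its content is already the limit. *)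
Lemma written_correct t j : j < coutpos (run M p t) ->
  cout (run M p t) j = Some (unary q j).
Proof.
move=> /(one_way_written _ M1) h; have [N _ hN] := Mpq j.
have /= <- := hN _ (leq_maxl N t).
by apply/esym; apply: (one_way_keeps M1) h; exact: leq_maxr.
Qed.

Lemma zeros_zero_count t :
  zeros M (unary p) t = zero_count q (coutpos (run M p t)).
Proof.
rewrite one_way_zeros //; apply: eq_in_count => j; rewrite mem_iota add0n => /= jt.
by rewrite [X in X == _](written_correct jt); case: unary.
Qed.

Lemma zeros_unbounded k : exists t, k < zeros M (unary p) t.
Proof.
have [N _ /(_ N (leqnn N)) /= hN] := Mpq (zero_pos q k).
exists N; rewrite zeros_zero_count; apply: (@leq_trans (zero_count q (zero_pos q k).+1)).
  by rewrite zero_countS zero_count_pos unary_zero addn1.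
by apply: leq_zero_count; apply/(one_way_written _ M1); rewrite -/(run M p N) hN.
Qed.

End Use.

(** During [t] steps only cells below [t] are read, so both runs agree up to time [t]. By then more
    than [k] zeros are written, so entry [k] is complete in both outputs. *)
Lemma use_principle M p q p' q' t k : one_way M -> produces M p q ->
  produces M p' q' -> k < zeros M (unary p) t ->
  (forall j, j < t -> unary p j = unary p' j) -> q k = q' k.
Proof.
move=> M1 Mpq Mpq' kt h.
apply: (@unary_prefix _ _ _ (coutpos (run M p t))) => [|j jt].
  rewrite ltnNge; apply/negP => /(leq_zero_count q).
  by rewrite zero_count_pos -(zeros_zero_count M1 Mpq) leqNgt kt.
have e : run M p t = run M p' t by exact: iter_step_local.
have jt' : j < coutpos (run M p' t) by rewrite -e.
have [<-] : Some (unary q' j) = Some (unary q j); last by [].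
by rewrite -(written_correct M1 Mpq jt) -(written_correct M1 Mpq' jt') e.
Qed.

(** * The guessed function *)

Definition dist u v := (u - v) + (v - u).

(* The [n]-th bump, [n = <i, t>], is switched on if machine [i] with oracle [o]
   writes its [i + 3]-rd zero on the zero name in exactly [t] steps.  This
   happens for at most one [t], and then it depends only on [o] up to [t]. *)
Definition crossing (o : baire) (n : nat) : bool :=
  let x := unary (interleave o (fun=> 0)) in
  let M := nth_machine (Cantor.of_nat n).1 in
  (zeros M x (Cantor.of_nat n).2.-1 <= (Cantor.of_nat n).1 + 2) &&
  ((Cantor.of_nat n).1 + 2 < zeros M x (Cantor.of_nat n).2).

Definition halted_by (s : nat) : baire :=
  fun k => sim_halted (nth_machine k) (unary (fun=> 0)) s.

Lemma leq_zeros M x s t : s <= t -> zeros M x s <= zeros M x t.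
Proof.
by move=> /subnK <-; elim: (t - s) => // k IH; rewrite addSn zerosS (leq_trans IH) ?leq_addr.
Qed.

(** The number of zeros never decreases, so it passes [i + 2] at most once. *)
Lemma crossing_unique o i t t' : crossing o (Cantor.to_nat (i, t)) ->
  crossing o (Cantor.to_nat (i, t')) -> t = t'.
Proof.
rewrite /crossing !Cantor.cancel_of_to /= => /andP[h1 h2] /andP[h1' h2'].
set M := nth_machine i in h1 h2 h1' h2'; set x := unary _ in h1 h2 h1' h2'.
case: (ltngtP t t') => // lt.
  have : t <= t'.-1 by lia.
  by move/(leq_zeros M x); lia.
have : t' <= t.-1 by lia.
by move/(leq_zeros M x); lia.
Qed.

Lemma crossing_exists M q : one_way M ->
  produces M (interleave halting_problem (fun=> 0)) q ->
  exists t, crossing halting_problem (Cantor.to_nat (pickle M, t)).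
Proof.
move=> M1 /(zeros_unbounded M1)/(_ (pickle M + 2)) ex.
case: (ex_minnP ex) => t ht min; exists t.
rewrite /crossing Cantor.cancel_of_to /= /nth_machine pickleK /= ht andbT leqNgt.
(* The least [t] is the crossing; [t = 0] is excluded because nothing is written at the start, and
   this makes [t.-1] a genuine predecessor. *)
apply/negP => /min; case: t ht {min} => [|t _]; last by rewrite ltnn.
by rewrite /zeros.
Qed.

(** Running [t] steps reads cells below [t], which are determined by the oracle below [t]; these
    finitely many values of [halted_by s] settle. *)
Lemma crossing_limit n : exists s0, forall s, s0 <= s ->
  crossing (halted_by s) n = crossing halting_problem n.
Proof.
pose t := (Cantor.of_nat n).2.
have [s0 hs0] : exists s0, forall s, s0 <= s -> forall k, k < t ->
    halted_by s k = halting_problem k.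
  elim: (t) => [|k [s0 IH]]; first by exists 0.
  pose P := halts (nth_machine k) (fun=> 0).
  have [s1 hs1] : exists s1, forall s, s1 <= s -> halted_by s k = halting_problem k.
    rewrite /halting_problem /jump; case: asboolP => [/sim_halted_halts[s1 h]|h].
      by exists s1 => s ss; rewrite /halted_by (sim_halted_mono ss h).
    exists 0 => s _; rewrite /halted_by; case e : sim_halted => //.
    by case: h; apply/sim_halted_halts; exists s.
  exists (maxn s0 s1) => s; rewrite geq_max => /andP[ss0 ss1] j.
  rewrite ltnS leq_eqVlt => /predU1P[->|]; [exact: hs1|exact: IH].
exists s0 => s ss.
have h j : j < t -> unary (interleave (halted_by s) (fun=> 0)) j =
    unary (interleave halting_problem (fun=> 0)) j.
  move=> jt; apply: unary_local => m mj; rewrite /interleave; case: odd => //.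
  by apply: hs0 => //; lia.
have h' j : j < t.-1 -> unary (interleave (halted_by s) (fun=> 0)) j =
    unary (interleave halting_problem (fun=> 0)) j.
  by move=> jt; apply: h; lia.
by rewrite /crossing -/t (zeros_local _ h) (zeros_local _ h').
Qed.

(* With [a / d] the [n + 4]-th approximation of the input [x], the test says that
   [|2 ^ n * a / d - 1| < 5 / 16], where 5/16 is the half-width 1/4 of the bump
   plus the error 1/16.  Then [|2 ^ n * x - 1| < 6 / 16], which is outside of all
   the other bumps. *)
Definition near_bump (p : baire) (n : nat) : bool :=
  let: (a, c) := Cantor.of_nat (p (n + 4)) in
  16 * dist (2 ^ n * minn a c.+1) c.+1 < 5 * c.+1.

Definition first_near p s : option nat :=
  nat_rect (fun=> option nat) None
    (fun n acc => if acc is Some m then Some m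
                  else if near_bump p n then Some n else None) s.

(** The guess 0 stands for the value 0, [n.+1] for bump [n]. Once found, the first near bump is
    kept; afterwards only the test of the oracle can be revised. *)
Definition guess (p : baire) (s : nat) : nat :=
  if first_near p s is Some n
  then if crossing (halted_by s) n then n.+1 else 0 else 0.

(** A natural number, hence the inverse of the actual height. *)
Definition bump_height (n : nat) := 2 ^ (Cantor.of_nat n).1.

(* The value of the bump at [a / d], [d = c + 1], is
   [max (0, d - |2 ^ (n + 2) * a - 4 * d|) / (2 ^ i * d)]; truncated subtraction
   takes the maximum. *)
Definition bump_code (n a c : nat) : nat :=
  Cantor.to_nat (Cantor.to_nat
    (c.+1 - dist (2 ^ (n + 2) * minn a c.+1) (4 * c.+1), 0),
    (bump_height n * c.+1).-1).

(** The shift by [n + 2], with [n = c.-1], compensates for the Lipschitz constant 2 ^ (n + 2) of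
    bump [n]. *)
Definition guess_output (p : baire) (c : nat) : baire := fun j =>
  if c == 0 then 0 else
  bump_code c.-1 (Cantor.of_nat (p (j + c.-1 + 2))).1 (Cantor.of_nat (p (j + c.-1 + 2))).2.

Lemma near_first p n : near_bump p n -> exists m, near_bump p m /\
  forall s, n < s -> first_near p s = Some m.
Proof.
move=> pn; have [m mp] : exists m, first_near p n.+1 = Some m.
  by rewrite /= pn; case: first_near => [m|]; [exists m|exists n].
exists m; split.
  move: mp; elim: n.+1 => //= k; case: first_near => [m' IH e|_]; first exact: IH.
  by case: ifP => // pk [<-].
by move=> s /subnK <-; elim: (s - n.+1) => // k IH; rewrite addSn /= IH.
Qed.

Lemma far_first p : (forall n, ~~ near_bump p n) -> forall s, first_near p s = None.
Proof. by move=> h; elim=> //= s ->; rewrite (negbTE (h s)). Qed.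

(** * The guesses and their outputs are primitive recursive *)

Section GuessClosure.
Let pc_minn (X : countType) a b : pc a -> pc b -> pc (fun p (x : X) => minn (a p x) (b p x)).
Proof.
move=> ha hb; apply: (@pc_ext X nat (fun p x => a p x - (a p x - b p x))); first by pcs.
by move=> p x; lia.
Qed.

Let pc_dist (X : countType) a b : pc a -> pc b -> pc (fun p (x : X) => dist (a p x) (b p x)).
Proof. by move=> ha hb; rewrite /dist; pcs. Qed.

Let pc_interleave (X : countType) (q r : baire -> X -> baire) m :
  pc (fun p (y : X * nat) => q p y.1 y.2) -> pc (fun p (y : X * nat) => r p y.1 y.2) ->
  pc m -> pc (fun p x => interleave (q p x) (r p x) (m p x)).
Proof. by move=> hq hr hm; rewrite /interleave; pcs. Qed.

Lemma guess_pc : pc guess.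
Proof.
have hM := pc_nth_machine.
have hH : pc (fun (p : baire) (y : nat * nat) => halted_by y.1 y.2).
  rewrite /halted_by; pcs; apply: pc_sim_halted; pcs.
  by apply: (pc_comp hM); pcs.
have hz (b : nat -> nat) :
  (forall (X : countType) a, pc a -> pc (fun p (x : X) => b (a p x))) ->
  pc (fun (p : baire) (y : nat * nat) => zeros (nth_machine (Cantor.of_nat y.2).1)
    (unary (interleave (halted_by y.1) (fun=> 0))) (b (Cantor.of_nat y.2).2)).
  move=> hb; apply: pc_zeros; pcs; first by apply: (pc_comp hM); pcs.
    apply: (pc_interleave (q := fun _ y => halted_by y.1.1.1) (r := fun _ _ _ => 0)
      (m := fun _ y => y.2)); pcs.
    by apply: (pc_app2 (F := fun _ => halted_by) hH); pcs.
  by apply: (hb _ (fun _ y => (Cantor.of_nat y.2).2)); pcs.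
have hC : pc (fun (p : baire) (y : nat * nat) => crossing (halted_by y.1) y.2).
  rewrite /crossing; pcs; first by apply: (hz predn) => X a ha; pcs.
  by apply: (hz id).
have hN : pc near_bump.
  apply: (@pc_ext _ bool (fun p n =>
    16 * dist (2 ^ n * minn (Cantor.of_nat (p (n + 4))).1 (Cantor.of_nat (p (n + 4))).2.+1)
      (Cantor.of_nat (p (n + 4))).2.+1 < 5 * (Cantor.of_nat (p (n + 4))).2.+1)).
    have hp : pc (fun p n => p (n + 4)) by apply: pc_input; pcs.
    by pcs; apply: pc_dist; pcs; apply: pc_minn; pcs.
  by move=> p n; rewrite /near_bump; case: (Cantor.of_nat _).
by rewrite /guess /first_near; pcs.
Qed.

Lemma guess_output_pc : pc (fun p (y : nat * nat) => guess_output p y.1 y.2).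
Proof.
have hp : pc (fun p (y : nat * nat) => p (y.2 + y.1.-1 + 2)) by apply: pc_input; pcs.
rewrite /guess_output /bump_code /bump_height; pcs.
by apply: pc_dist; pcs; apply: pc_minn; pcs.
Qed.
End GuessClosure.

(** * The bumps as real functions *)

Section Bumps.
Variable R : realType.
Import Order.TTheory GRing.Theory Num.Theory.
Local Open Scope ring_scope.

Let alpha := @unit_rat_numbering R.

Lemma natr_sub_max u v : (u - v)%N%:R = Num.max 0 (u%:R - v%:R) :> R.
Proof.
have [le|lt] := leqP v u.
  by rewrite natrB // max_r // subr_ge0 ler_nat.
have -> : (u - v = 0)%N by lia.
by rewrite max_l // subr_le0 ler_nat ltnW.
Qed.

Lemma natr_dist u v : (dist u v)%:R = `|u%:R - v%:R| :> R.
Proof.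
rewrite /dist natrD; have [le|lt] := leqP v u.
  have -> : (v - u = 0)%N by lia.
  by rewrite addr0 natrB // ger0_norm // subr_ge0 ler_nat.
have -> : (u - v = 0)%N by lia.
by rewrite add0r natrB 1?ltnW // ler0_norm ?opprB // subr_le0 ler_nat ltnW.
Qed.

(** A tent with peak 1 at 2 ^- n, slope 2 ^ (n + 2) and support between 3/4 and 5/4 of 2 ^- n. *)
Definition bump (n : nat) (y : R) : R := Num.max 0 (1 - `|2 ^+ (n + 2) * y - 4|).

Definition term (n : nat) (y : R) : R := bump n y / (bump_height n)%:R.

Lemma bump_height_gt0 n : 0 < (bump_height n)%:R :> R.
Proof. by rewrite ltr0n expn_gt0. Qed.

Lemma bump_ge0 n y : 0 <= bump n y.
Proof. by rewrite /bump le_max lexx. Qed.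

Lemma bump_le1 n y : bump n y <= 1.
Proof. by rewrite /bump ge_max ler01 gerBl normr_ge0. Qed.

Lemma bump_gt0 n y : (0 < bump n y) = (3 < 2 ^+ (n + 2) * y < 5).
Proof.
rewrite /bump lt_max ltxx subr_gt0 ltr_norml.
by apply/andP/andP => -[h1 h2]; split; lra.
Qed.

Lemma term_ge0 n y : 0 <= term n y.
Proof. by rewrite divr_ge0 ?bump_ge0 // ltW ?bump_height_gt0. Qed.

Lemma unit_rat_numberingE m : alpha m =
  (minn (Cantor.of_nat m).1 (Cantor.of_nat m).2.+1)%:R / (Cantor.of_nat m).2.+1%:R.
Proof. by rewrite /alpha /unit_rat_numbering; case: (Cantor.of_nat m). Qed.

Lemma bump_codeE n m : rat_numbering R
  (bump_code n (Cantor.of_nat m).1 (Cantor.of_nat m).2) = term n (alpha m).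
Proof.
rewrite unit_rat_numberingE /bump_code; set a := minn _ _; set d := _.+1.
have d0 : 0 < d%:R :> R by rewrite ltr0n.
rewrite /rat_numbering !Cantor.cancel_of_to subr0 prednK; last first.
  by rewrite muln_gt0 expn_gt0.
rewrite natrM /term invfM mulrA mulrAC; congr (_ / _).
rewrite natr_sub_max natr_dist !natrM natrX /bump -[LHS]mulrC.
rewrite maxr_pMr ?invr_ge0 ?ltW // mulr0; congr (Num.max _ _).
rewrite mulrBr mulVf ?gt_eqF //; congr (_ - _).
rewrite -[X in X * _]ger0_norm ?invr_ge0 ?ltW // -normrM; congr (`| _ |).
by field; rewrite gt_eqF.
Qed.

Lemma bump_lipschitz n x y : `|bump n x - bump n y| <= 2 ^+ (n + 2) * `|x - y|.
Proof.
have h0 : 0 < 2 ^+ (n + 2) :> R by rewrite exprn_gt0.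
rewrite -[X in X * _](ger0_norm (ltW h0)) -normrM mulrBr /bump.
move: (_ * x) (_ * y) => u v.
have : `| `|u - 4| - `|v - 4| | <= `|u - v|.
  by apply: le_trans (ler_dist_dist _ _) _; rewrite opprB addrA subrK.
move: (`|u - v|) (`|u - 4|) (`|v - 4|) => w a b; rewrite !ler_norml => /andP[h1 h2].
by rewrite /Num.max; do 2!case: ltP => ?; apply/andP; split; lra.
Qed.

Lemma term_lipschitz n x y : `|term n x - term n y| <= 2 ^+ (n + 2) * `|x - y|.
Proof.
rewrite /term -mulrBl normrM; apply: le_trans (bump_lipschitz n x y).
rewrite [`|_^-1|]ger0_norm ?invr_ge0 ?ler0n //.
apply: ler_piMr => //; rewrite invf_le1 ?bump_height_gt0 //.
by rewrite ler1n expn_gt0.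
Qed.

Lemma scale_le n m (z : R) : (n < m)%N -> 0 <= z -> 2 * (2 ^+ n * z) <= 2 ^+ m * z.
Proof.
move=> nm z0; rewrite mulrA -exprS; apply: ler_wpM2r => //.
by apply: ler_weXn2l => //; lra.
Qed.

(** In units of 2 ^- (n + 2), the hypothesis places [x] strictly between 5/2 and 11/2. A bump
    occupies 3 to 5 of its own units; for an earlier one this means beyond 6, for a later one below
    5/2. *)
Lemma bump_far n m (x : R) : `|2 ^+ (n + 4) * x - 16| < 6 -> 0 < bump m x -> m = n.
Proof.
rewrite bump_gt0 ltr_norml => /andP[h1 h2] /andP[h3 h4].
have e : 2 ^+ (n + 4) * x = 4 * (2 ^+ (n + 2) * x).
  by rewrite !exprD; ring.
have x0 : 0 <= x.
  by rewrite -(pmulr_rge0 x (exprn_gt0 (m + 2) (ltr0Sn R 1))); lra.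
have le : (m < n)%N -> 2 * (2 ^+ (m + 2) * x) <= 2 ^+ (n + 2) * x.
  by move=> lt; apply: scale_le => //; rewrite ltn_add2r.
have ge : (n < m)%N -> 2 * (2 ^+ (n + 2) * x) <= 2 ^+ (m + 2) * x.
  by move=> lt; apply: scale_le => //; rewrite ltn_add2r.
move: e h1 h2 h3 h4 le ge.
move: (2 ^+ (n + 4) * x) (2 ^+ (n + 2) * x) (2 ^+ (m + 2) * x) => u v w.
move=> -> h1 h2 h3 h4 le ge.
by case: (ltngtP m n) => [/le|/ge|//] h5; exfalso; clear le ge; lra.
Qed.

Lemma bump_unique n m (x : R) : 0 < bump n x -> 0 < bump m x -> m = n.
Proof.
rewrite bump_gt0 => /andP[h1 h2]; apply: bump_far.
have -> : 2 ^+ (n + 4) * x = 4 * (2 ^+ (n + 2) * x) by rewrite !exprD; ring.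
by rewrite ltr_norml; apply/andP; split; lra.
Qed.

Lemma near_bumpE p n :
  near_bump p n = (`|2 ^+ (n + 4) * alpha (p (n + 4)%N) - 16| < 5).
Proof.
rewrite unit_rat_numberingE /near_bump; case: (Cantor.of_nat _) => a c /=.
set a' := minn a _; set d := c.+1.
have d0 : 0 < d%:R :> R by rewrite ltr0n.
have -> : 2 ^+ (n + 4) * (a'%:R / d%:R) - 16 = 16 * (2 ^+ n * a'%:R - d%:R) / d%:R :> R.
  by rewrite exprD; field; rewrite gt_eqF.
rewrite normrM normfV (gtr0_norm d0) ltr_pdivrMr // normrM.
rewrite -(ltr_nat R) !natrM natr_dist natrM natrX.
by rewrite [`|16|]ger0_norm.
Qed.

Lemma name_dist (X : set R) (beta : nat -> R) p x k :
  cauchy_rep X beta p x -> `|x - beta (p k)| <= 2 ^- k.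
Proof.
move=> [_ pk px]; apply/ler_addgt0Pr => e e0.
have [N _ hN] := (cvgrPdist_lt _ _).1 px e e0.
have := hN (maxn N k) (leq_maxl _ _); have := pk k (maxn N k) (leq_maxr _ _).
rewrite /=; set u := beta _; set v := beta _ => h1 h2.
by have := ler_distD u x v; lra.
Qed.

(** * The function and its uniform continuity *)

Definition on_bump x n := crossing halting_problem n && (0 < bump n x).

(** The supports are disjoint, so the sum of the series at [x] is its only nonzero term, if any;
    choosing that term avoids infinite sums. *)
Definition bumpy (x : R) : R :=
  if pselect (exists n, on_bump x n) is left h then term (projT1 (cid h)) x else 0.

Lemma bumpy_on x n : on_bump x n -> bumpy x = term n x.
Proof.
move=> xn; rewrite /bumpy; case: pselect => [h|[]]; last by exists n.
case: cid => m /= /andP[_ xm]; case/andP: xn => _ xn.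
by rewrite (bump_unique xn xm).
Qed.

Lemma bumpy_off x : (forall n, ~~ on_bump x n) -> bumpy x = 0.
Proof.
by move=> h; rewrite /bumpy; case: pselect => // -[n xn]; move: (h n); rewrite xn.
Qed.

(** A lower bound that does not require knowing which bump [x] lies on; it serves to compare two
    points through a bump of only one of them. *)
Lemma bumpy_ge x n : crossing halting_problem n -> term n x <= bumpy x.
Proof.
move=> cn; have [n0|n0] := ltP 0 (bump n x).
  by rewrite (@bumpy_on _ n) // /on_bump cn.
have -> : term n x = 0.
  by rewrite /term (_ : bump n x = 0) ?mul0r //; apply/le_anti; rewrite n0 bump_ge0.
rewrite /bumpy; case: pselect => // h; exact: term_ge0.
Qed.

Lemma bumpy_cases x : bumpy x = 0 \/ exists2 n, on_bump x n & bumpy x = term n x.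
Proof.
rewrite /bumpy; case: pselect => [h|]; last by left.
by right; case: cid => n xn; exists n.
Qed.

(** Height at least [e] leaves finitely many [i], and [crossing_unique] leaves at most one active
    bump for each of them. *)
Lemma high_bumps (e : R) : 0 < e -> exists N, forall n x,
  crossing halting_problem n -> e <= term n x -> (n < N)%N.
Proof.
move=> e0; have [I hI] : exists I, forall n x, e <= term n x -> ((Cantor.of_nat n).1 < I)%N.
  exists (Num.bound e^-1) => n x h; rewrite ltnNge; apply/negP => le.
  suff lt : (bump_height n)%:R^-1 < e.
    have h2 : term n x <= (bump_height n)%:R^-1.
      by rewrite /term ler_piMl ?bump_le1 // invr_ge0 ltW ?bump_height_gt0.
    by have := le_lt_trans (le_trans h h2) lt; rewrite ltxx.
  rewrite -[e]invrK ltf_pV2 ?posrE ?invr_gt0 ?bump_height_gt0 //.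
  have b : e^-1 < (Num.bound e^-1)%:R.
    by apply: archi_boundP; rewrite invr_ge0 ltW.
  apply: lt_trans b _; rewrite ltr_nat.
  by apply: leq_ltn_trans le _; rewrite ltn_expl.
have {}hI n x : e <= term n x -> ((Cantor.of_nat n).1 < I)%N by exact: hI.
suff [N hN] : exists N, forall n, crossing halting_problem n ->
    ((Cantor.of_nat n).1 < I)%N -> (n < N)%N.
  by exists N => n x cn /hI; exact: hN.
elim: I {hI} => [|I [N IH]]; first by exists 0%N.
have [[t ct]|no] := pselect (exists t, crossing halting_problem (Cantor.to_nat (I, t))).
  exists (maxn N (Cantor.to_nat (I, t)).+1) => n cn.
  rewrite ltnS leq_eqVlt leq_max => /predU1P[eI|lt]; last by rewrite (IH n).
  apply/orP; right; rewrite ltnS -(Cantor.cancel_to_of n).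
  move: cn; rewrite -{1}(Cantor.cancel_to_of n) [Cantor.of_nat n]surjective_pairing eI.
  by move=> /crossing_unique/(_ ct) ->.
exists N => n cn; rewrite ltnS leq_eqVlt => /predU1P[eI|lt]; last exact: IH.
case: no; exists (Cantor.of_nat n).2.
by rewrite -eI -surjective_pairing Cantor.cancel_to_of.
Qed.

(** If the term at [x] is below e/2, then [0 <= bumpy y] suffices. Otherwise its index is below [N],
    so its slope is at most 2 ^ (N + 2), and [bumpy_ge] bounds [bumpy y] from below. The one-sided
    estimate for all pairs yields both sides. *)
Lemma bumpy_uniform (e : R) : 0 < e ->
  exists2 d, 0 < d & forall x y, `|x - y| < d -> `|bumpy x - bumpy y| < e.
Proof.
move=> e0; pose e2 := e / 2; have e20 : 0 < e2 by rewrite divr_gt0.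
have [N hN] := high_bumps e20.
have p0 : 0 < 2 ^+ (N + 2) :> R by rewrite exprn_gt0.
exists (e2 / 2 ^+ (N + 2)); first by rewrite divr_gt0.
have one x y : `|x - y| < e2 / 2 ^+ (N + 2) -> bumpy x - bumpy y < e.
  rewrite ltr_pdivlMr // => xy.
  have y0 : 0 <= bumpy y.
    by have [->//|[n _ ->]] := bumpy_cases y; exact: term_ge0.
  have [->|[n /andP[cn _] ->]] := bumpy_cases x; first by lra.
  have [lt|le] := ltP (term n x) e2; first by rewrite /e2 in lt; lra.
  have nN := hN n x cn le; have := bumpy_ge y cn.
  have : term n x - term n y <= e2.
    apply: le_trans (ler_norm _) _; apply: le_trans (term_lipschitz _ _ _) _.
    apply: le_trans (ltW xy); rewrite mulrC ler_wpM2l //.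
    by apply: ler_weXn2l; [lra|lia].
  by rewrite /e2; lra.
move=> x y xy; rewrite ltr_norml; apply/andP; split; last exact: one.
by have := one y x; rewrite distrC => /(_ xy); lra.
Qed.

Lemma bumpy_unif_continuous :
  unif_continuous (bumpy : subspace (@unit_interval R) -> R).
Proof.
apply/unif_continuousP => e e0; have [d d0 h] := bumpy_uniform e0.
exists d => // -[x y].
(* In the subspace topology points outside the interval are isolated, so there closeness means
   equality. *)
rewrite ball_subspace_ball /subspace_ball /=; case: ifP => _.
  by move=> [_ xy]; exact: h.
by move=> ->; exact: ballxx.
Qed.

(** * From names to bumps: the realizer *)

Lemma scaled_name_dist p x n : delta_unit p x ->
  `|2 ^+ n * x - 2 ^+ n * alpha (p n)| <= 1.
Proof.
move=> /(@name_dist _ _ _ _ n) h.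
rewrite -mulrBr normrM ger0_norm ?exprn_ge0 //.
by rewrite -ler_pdivlMl ?exprn_gt0 // mulr1.
Qed.

Lemma far_off_bump p x m n : delta_unit p x -> near_bump p n -> 0 < bump m x -> m = n.
Proof.
move=> px; rewrite near_bumpE => pn; apply: bump_far.
have := scaled_name_dist (n + 4) px; move: pn.
move: (2 ^+ (n + 4) * x) (2 ^+ (n + 4) * _) => u v.
rewrite !ltr_norml ler_norml => /andP[h1 h2] /andP[h3 h4].
by apply/andP; split; lra.
Qed.

Lemma on_bump_near p x n : delta_unit p x -> 0 < bump n x -> near_bump p n.
Proof.
move=> px; rewrite near_bumpE bump_gt0.
have e : 2 ^+ (n + 4) * x = 4 * (2 ^+ (n + 2) * x) by rewrite !exprD; ring.
have := scaled_name_dist (n + 4) px; move: e.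
move: (2 ^+ (n + 4) * x) (2 ^+ (n + 2) * x) (2 ^+ (n + 4) * _) => u w v ->.
rewrite ltr_norml ler_norml => /andP[h1 h2] /andP[h3 h4].
by apply/andP; split; lra.
Qed.

Lemma delta_real_zero : delta_real (fun=> 0%N) (0 : R).
Proof.
have e : rat_numbering R 0 = 0 by rewrite /rat_numbering /= subrr mul0r.
split=> // [k n _|]; first by rewrite subrr normr0 invr_gt0 exprn_gt0.
by rewrite e; exact: cvg_cst.
Qed.

Lemma delta_real_term p x n :
  delta_unit p x -> delta_real (guess_output p n.+1) (term n x).
Proof.
move=> px; have code j : rat_numbering R (guess_output p n.+1 j) =
    term n (alpha (p (j + n + 2)%N)) by rewrite /guess_output /= bump_codeE.
have p0 : 0 < 2 ^+ (n + 2) :> R by rewrite exprn_gt0.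
have ex k : 2 ^+ (n + 2) * 2 ^- (k + n + 2) = 2 ^- k :> R.
  by rewrite -addnA [_ ^+ (k + _)%N]exprD invfM mulrC -mulrA mulVf ?mulr1 // gt_eqF.
split=> // [k j kj|].
  rewrite !code; apply: le_lt_trans (term_lipschitz _ _ _) _.
  rewrite -(ex k) ltr_pM2l //; case: px => _ pk _; apply: pk.
  by rewrite !leq_add2r.
have [_ _ xl] := px.
apply/cvgrPdist_lt => e e0.
have [N _ hN] := (cvgrPdist_lt _ _).1 xl (e / 2 ^+ (n + 2)) (divr_gt0 e0 p0).
exists N => // j /= Nj; rewrite code; apply: le_lt_trans (term_lipschitz _ _ _) _.
rewrite mulrC -ltr_pdivlMr //; apply: (hN (j + n + 2)%N).
by rewrite /= -addnA (leq_trans Nj) // leq_addr.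
Qed.

(** If no bump ever looks near, as at 0, the initial guess is kept and is right. Otherwise the first
    near bump is the only candidate, and only the oracle values still have to settle. *)
Lemma bumpy_realized : realizes (guess_function guess guess_output) bumpy.
Proof.
move=> p x px; have [[n pn]|no] := pselect (exists n, near_bump p n); last first.
  have no' n : ~~ near_bump p n by apply/negP => pn; apply: no; exists n.
  have g0 s : guess p s = 0%N by rewrite /guess far_first.
  exists (fun=> 0%N).
    by exists 0%N => [s _|]; rewrite ?g0.
  rewrite bumpy_off; first exact: delta_real_zero.
  move=> n; apply/negP => /andP[_ /(on_bump_near px)]; exact/negP.
have [m [pm fm]] := near_first pn; have [s1 hs1] := crossing_limit m.
pose s0 := maxn n.+1 s1.
have gs s : (s0 <= s)%N -> guess p s = if crossing halting_problem m then m.+1 else 0%N.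
  by rewrite geq_max => /andP[h1 h2]; rewrite /guess fm // hs1.
have st : stable_from guess p s0 by move=> s ss; rewrite gs // gs.
exists (guess_output p (guess p s0)); first by exists s0.
rewrite gs //; case: ifP => cm; last first.
  rewrite bumpy_off; first exact: delta_real_zero.
  move=> l; apply/negP => /andP[cl /(far_off_bump px pm) e].
  by rewrite -e cl in cm.
have -> : bumpy x = term m x; last exact: delta_real_term.
(* Near does not imply on: where the tent vanishes, both sides are 0. *)
have [b0|b0] := ltP 0 (bump m x); first by apply: bumpy_on; rewrite /on_bump cm.
rewrite bumpy_off => [|l].
  by rewrite /term (_ : bump m x = 0) ?mul0r //; apply/le_anti; rewrite b0 bump_ge0.
apply/negP => /andP[_ bl]; have e := far_off_bump px pm bl.
by rewrite e ltNge b0 in bl.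
Qed.

(** * Diagonalisation against machines with oracle [0'] *)

Definition peak_name n : baire :=
  fun m => if (m < n)%N then 0%N else Cantor.to_nat (1, (2 ^ n).-1)%N.

(** A name may jump from 0 to 2 ^- n at index [n], since 2 ^- n < 2 ^- k for all k < n. *)
Lemma delta_unit_peak n : delta_unit (peak_name n) (2 ^- n : R).
Proof.
have p0 : 0 < 2 ^- n :> R by rewrite invr_gt0 exprn_gt0.
have hi m : (n <= m)%N -> alpha (peak_name n m) = 2 ^- n.
  move=> nm; rewrite unit_rat_numberingE /peak_name ltnNge nm Cantor.cancel_of_to /=.
  rewrite prednK ?expn_gt0 // (minn_idPl _) ?expn_gt0 //.
  by rewrite div1r natrX.
have lo m : (m < n)%N -> alpha (peak_name n m) = 0.
  by move=> nm; rewrite unit_rat_numberingE /peak_name nm /= min0n mul0r.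
split.
- rewrite /unit_interval /= in_itv /= ltW //=.
  by rewrite invf_le1 ?exprn_gt0 // exprn_ege1 //; lra.
- move=> k m km; rewrite -/alpha.
  have pk : 0 < 2 ^- k :> R by rewrite invr_gt0 exprn_gt0.
  have [nk|kn] := leqP n k; first by rewrite !hi ?subrr ?normr0 // (leq_trans nk).
  rewrite (lo k) // subr0; have [nm|mn] := leqP n m; last by rewrite lo ?normr0.
  rewrite hi // gtr0_norm // ltf_pV2 ?posrE ?exprn_gt0 //.
  by rewrite ltr_eXn2l //; lra.
- apply/cvgrPdist_lt => e e0; exists n => // m /= nm.
  by rewrite -/alpha hi // subrr normr0.
Qed.

Lemma delta_unit_zero : delta_unit (fun=> 0%N) (0 : R).
Proof.
have e : alpha 0 = 0 by rewrite unit_rat_numberingE /= mul0r.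
split=> [|k n _|].
- by rewrite /unit_interval /= in_itv /= lexx ler01.
- by rewrite subrr normr0 invr_gt0 exprn_gt0.
- by rewrite -/alpha e; exact: cvg_cst.
Qed.

Lemma bumpy_not_computable :
  ~ has_realizer (computable_relative_to halting_problem) bumpy.
Proof.
move=> [F rF [G [M M1 MG] FG]].
have [q0 /FG/MG Mq0 dq0] := rF _ _ delta_unit_zero.
have [t ct] := crossing_exists M1 Mq0; set n := Cantor.to_nat _ in ct.
have [q' /FG/MG Mq' dq'] := rF _ _ (delta_unit_peak n).
have tn : (t <= n)%N.
  by have := Cantor.to_nat_non_decreasing (pickle M) t; rewrite -/n; lia.
have b0 : bumpy 0 = 0.
  apply: bumpy_off => m; apply/negP => /andP[_]; rewrite bump_gt0 mulr0; lra.
have peak : 2 ^+ (n + 2) * 2 ^- n = 4 :> R.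
  by rewrite exprD mulrAC mulfV ?mul1r ?expf_neq0 //; lra.
have b1 : bumpy (2 ^- n) = 2 ^- (pickle M).
  rewrite (@bumpy_on _ n); last first.
    by rewrite /on_bump ct bump_gt0 peak; lra.
  rewrite /term /bump peak subrr normr0 subr0 max_r ?ler01 // div1r.
  by rewrite /bump_height /n Cantor.cancel_of_to natrX.
have qq : q0 (pickle M + 2)%N = q' (pickle M + 2)%N.
  (* Entry [i + 2], with [i = pickle M], is complete at time [t] by the crossing; the tapes agree on
     their first [t] cells because [t <= n]. *)
  apply: (use_principle M1 Mq0 Mq' (t := t)).
    move: ct; rewrite /crossing /n Cantor.cancel_of_to /= => /andP[_].
    by rewrite /nth_machine pickleK.
  move=> j jt; apply: unary_local => m mj; rewrite /interleave; case: odd => //.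
  by rewrite /peak_name ifT //; lia.
have := name_dist (pickle M + 2) dq0; have := name_dist (pickle M + 2) dq'.
rewrite b0 b1 qq exprD invfM; set u := rat_numbering R _.
have : 0 < 2 ^- pickle M :> R by rewrite invr_gt0 exprn_gt0.
move: (2 ^- pickle M) => w w0; rewrite !ler_norml => /andP[h1 h2] /andP[h3 h4].
(* The accuracy of entry [i + 2] is a quarter of the peak value [w], and no number is within w/4 of
   both 0 and [w]. *)
have e4 : (2 ^+ 2)^-1 = 1 / 4 :> R by rewrite div1r; congr (_^-1); ring.
by rewrite e4 in h1 h2 h3 h4; lra.
Qed.

End Bumps.

Theorem proposition6p9 (R : realType) :
  exists f : R -> R,
    unif_continuous (f : subspace (@unit_interval R) -> R) /\
    has_realizer computable_fin_mind_changes f /\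
    has_realizer low f /\
    has_realizer limit_computable f /\
    ~ has_realizer (computable_relative_to halting_problem) f.
Proof.
exists (@bumpy R); split; first exact: bumpy_unif_continuous.
have [h1 h2 h3] := guess_realizers guess_pc guess_output_pc (@bumpy_realized R).
by do !split=> //; exact: bumpy_not_computable.
Qed.
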